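(* Let $X$ be a $2$-connected, locally finite graph with a deterministic edge labelling $\ell$, and let $\Gamma\le\mathrm{AUT}(X,\ell)$ act quasi-transitively on $X$. If every end of $X$ has size at most $2$, then for every $o\in VX$ the language $L_{\mathrm{SAW},o}(X)$ is unambiguous context-free.
   Context: $X$ has no loops or multiple edges; edges are oriented, each undirected edge giving a pair of oppositely oriented edges, labelled by letters of a finite alphabet $\Sigma$. The labelling is deterministic if distinct oriented edges with the same initial vertex have distinct labels, and distinct oriented edges with the same terminal vertex have distinct labels. $\mathrm{AUT}(X,\ell)$ is the group of label-preserving automorphisms; quasi-transitive means finitely many orbits on vertices. A graph is $2$-connected if it has more than $2$ vertices and has no cutvertex. $L_{\mathrm{SAW},o}(X)\subseteq\Sigma^*$ is the set of labels (concatenations of edge labels) of all self-avoiding walks (walks visiting no vertex twice, including the empty walk) starting at $o$. Ends: equivalence classes of rays, two rays being equivalent if for every finite vertex set $K$ they have tails in the same component of $X\setminus K$; the size of an end is the maximal number of pairwise disjoint rays in it. A language is unambiguous context-free if it is generated by a context-free grammar in which every word of the language has a unique rightmost derivation. *)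

(* Defs.v *)
From HB Require Import structures.
From mathcomp Require Import all_boot.
From mathcomp Require Import boolp classical_sets functions cardinality.

Set Implicit Arguments.
Unset Strict Implicit.
Unset Printing Implicit Defensive.

Local Open Scope classical_set_scope.

(* A graph without loops or multiple edges on the vertex set V is a symmetric
   irreflexive relation [e : rel V]; its oriented edges are the pairs (x, y)
   with [e x y]. *)

Section Graphs.

Variables (V : choiceType) (e : rel V).

Definition locally_finite : Prop :=
  forall x : V, finite_set [set y | e x y].

Definition joined_off (K : set V) (x y : V) : Prop :=
  exists p : seq V,
    [/\ path e x p, last x p = y & forall z, z \in x :: p -> ~ K z].

Definition connected_off (K : set V) : Prop :=
  forall x y : V, ~ K x -> ~ K y -> joined_off K x y.

Definition cutvertex (v : V) : Prop := ~ connected_off [set v].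

Definition two_connected : Prop :=
  [/\ exists s : seq V, uniq s && (2 < size s),
      connected_off set0
    & forall v : V, ~ cutvertex v].

Definition ray (r : nat -> V) : Prop :=
  injective r /\ forall n : nat, e (r n) (r n.+1).

Definition ray_equiv (r s : nat -> V) : Prop :=
  forall K : set V, finite_set K ->
    exists m n : nat, forall i j : nat,
      m <= i -> n <= j -> joined_off K (r i) (s j).

Definition is_end (w : set (nat -> V)) : Prop :=
  exists2 r : nat -> V, ray r & w = [set s | ray s /\ ray_equiv r s].

Definition has_disjoint_rays (w : set (nat -> V)) (n : nat) : Prop :=
  exists f : 'I_n -> nat -> V,
    (forall i, w (f i)) /\ trivIset [set: 'I_n] (fun i => range (f i)).

(* An end containing arbitrarily large finite families of pairwise disjoint
   rays has no size in this sense: its size is infinite. *)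
Definition end_size (w : set (nat -> V)) (k : nat) : Prop :=
  has_disjoint_rays w k /\ forall n : nat, has_disjoint_rays w n -> n <= k.

(* The value [l x y] of a labelling is the label of the oriented edge (x, y);
   it is irrelevant when [e x y] is false. *)

Definition deterministic (S : Type) (l : V -> V -> S) : Prop :=
  (forall x y z : V, e x y -> e x z -> l x y = l x z -> y = z) /\
  (forall x y z : V, e x z -> e y z -> l x z = l y z -> x = y).

Definition label_aut (S : Type) (l : V -> V -> S) (g : V -> V) : Prop :=
  [/\ bijective g,
      forall x y : V, e (g x) (g y) = e x y
    & forall x y : V, e x y -> l (g x) (g y) = l x y].

Definition label_aut_subgroup (S : Type) (l : V -> V -> S)
    (G : set (V -> V)) : Prop :=
  [/\ G `<=` label_aut l,
      G id,
      forall g h : V -> V, G g -> G h -> G (g \o h)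
    & forall g : V -> V, G g -> exists2 h : V -> V,
        G h & cancel g h /\ cancel h g].

Definition orbit_of (G : set (V -> V)) (x : V) : set V := [set g x | g in G].

Definition quasi_transitive (G : set (V -> V)) : Prop :=
  finite_set (range (orbit_of G)).

(* [saw o p]: the walk with vertex sequence o :: p is self-avoiding. *)
Definition saw (o : V) (p : seq V) : bool := path e o p && uniq (o :: p).

Definition saw_language (S : Type) (l : V -> V -> S) (o : V) : set (seq S) :=
  [set pairmap l o p | p in [set p : seq V | saw o p]].

End Graphs.

Section Grammars.

Variable S : finType.

Record cfg := Cfg {
  nonterminal : finType;
  start : nonterminal;
  rules : seq (nonterminal * seq (nonterminal + S)) }.

Variable C : cfg.

Definition sform : Type := seq (nonterminal C + S).

Definition start_form : sform := [:: inl (start C)].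

Definition terminal_form (w : seq S) : sform := [seq inr a | a <- w].

Definition cfg_step (s t : sform) : Prop :=
  exists A beta u v,
    [/\ (A, beta) \in rules C, s = u ++ inl A :: v & t = u ++ beta ++ v].

Definition rightmost_step (s t : sform) : Prop :=
  exists A beta u w,
    [/\ (A, beta) \in rules C, s = u ++ inl A :: terminal_form w
      & t = u ++ beta ++ terminal_form w].

(* [p] lists the sentential forms after [start_form].  A rightmost step is
   determined by its two sentential forms (they give back the production used),
   so that derivations may be identified with sequences of sentential forms. *)
Definition derivation (step : sform -> sform -> Prop) (p : seq sform)
    (w : seq S) : Prop :=
  path (fun s t => `[< step s t >]) start_form p /\
  last start_form p = terminal_form w.

Definition cfg_language : set (seq S) :=
  [set w | exists p, derivation cfg_step p w].

Definition unambiguous_cfg : Prop :=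
  forall w, cfg_language w -> exists! p, derivation rightmost_step p w.

End Grammars.

Definition unambiguous_context_free (S : finType) (L : set (seq S)) : Prop :=
  exists2 C : cfg S, unambiguous_cfg C & cfg_language C = L.

(* Main.v *)
Require Import Defs.
From mathcomp Require Import all_boot zify.
From mathcomp Require Import boolp classical_sets functions cardinality.

(* Call a connected set disjoint from a finite set [K] and with at most two
   boundary vertices a [K]-cone.  Two [K]-cones that meet or are adjacent have a
   [K]-cone as union, so the maximal ones are disjoint, and their boundaries lie in
   the set [part K] of vertices in no [K]-cone.  If [part K] were infinite, then among
   the connected sets with finite boundary and infinitely many vertices in [part K]
   one could choose a decreasing sequence, each set having a boundary of minimal size
   among its subsets of that kind; Menger's theorem links the consecutive boundaries
   by disjoint paths, which gives at least three disjoint rays in one end.  So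
   [part K] is finite.  No vertex is a cutvertex, hence the two boundary vertices of a
   cone are at bounded distance, and there are finitely many cones up to [Gamma].

   A self-avoiding walk which enters a maximal cone [D] at one of its boundary
   vertices either ends in [D] without going beyond the other boundary vertex [y], or
   traverses [D], leaves through [y] and never comes back.  Cutting walks at this
   point gives a grammar in Greibach normal form, whose nonterminals are the finitely
   many languages of walks in a given union of vertices and maximal cones.  It is
   unambiguous since the labelling is deterministic. *)

Set Implicit Arguments.
Unset Strict Implicit.
Unset Printing Implicit Defensive.

Local Open Scope classical_set_scope.

(** * Unambiguous grammars in Greibach normal form *)

Section Factorizations.

Variables (S N : Type) (L : N -> set (seq S)).

(** A parse of [flatten ws] along the sentential form [s]: one word per symbol, with nonterminals
    read as languages. With [L := id] the languages themselves serve as nonterminals. *)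
Fixpoint factors (s : seq (N + S)) (ws : seq (seq S)) : Prop :=
  match s, ws with
  | [::], [::] => True
  | inl A :: s', w :: ws' => L A w /\ factors s' ws'
  | inr a :: s', w :: ws' => w = [:: a] /\ factors s' ws'
  | _, _ => False
  end.

Lemma factors_cat s1 s2 ws1 ws2 :
  factors s1 ws1 -> factors s2 ws2 -> factors (s1 ++ s2) (ws1 ++ ws2).
Proof.
elim: s1 ws1 => [|[A|a] s1 IH] [|w ws1] //= [Hw H1] H2; split=> //; exact: IH.
Qed.

Lemma factors_catP s1 s2 ws : factors (s1 ++ s2) ws ->
  exists ws1 ws2, [/\ ws = ws1 ++ ws2, factors s1 ws1 & factors s2 ws2].
Proof.
elim: s1 ws => [|X s1 IH] ws /=; first by exists [::], ws.
case: X ws => [A|a] [|w ws] //= [Hw /IH[ws1 [ws2 [-> H1 H2]]]].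
  by exists (w :: ws1), ws2.
by exists (w :: ws1), ws2.
Qed.

Lemma factors_size s ws : factors s ws -> size ws = size s.
Proof. by elim: s ws => [|[A|a] s IH] [|w ws] //= [_ /IH ->]. Qed.

Lemma factors_terminal (w : seq S) :
  factors [seq inr a | a <- w] [seq [:: a] | a <- w].
Proof. by elim: w => //= a w IH. Qed.

Lemma flatten_singletons (w : seq S) : flatten [seq [:: a] | a <- w] = w.
Proof. by elim: w => //= a w ->. Qed.

End Factorizations.

Section UnambiguousGrammars.

Variables (S : finType) (C : cfg S).
Variable L : nonterminal C -> set (seq S).

(** Only terminals follow the rightmost nonterminal, so a rightmost step has no choice of place. *)
Lemma rightmost_form_inj (u u' : sform C) A A' v v' :
  u ++ inl A :: terminal_form C v = u' ++ inl A' :: terminal_form C v' ->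
  [/\ u = u', A = A' & v = v'].
Proof.
have notin (x : sform C) B y w :
    inl A :: terminal_form C v = (x ++ inl B :: y) -> x <> [::] \/ B = A.
  by case: x => [|? ?] /= => [[]|]; [right|left].
have noinl (w : seq S) x (B : nonterminal C) y :
    terminal_form C w <> x ++ inl B :: y.
  by elim: w x => [|a w IH] [|X x] //= [_] /IH.
elim: u u' => [|X u IH] [|X' u'] //=.
- case=> -> H; split=> //; elim: v v' H {notin} => [|a v IHv] [|a' v'] //=.
  by case=> -> /IHv ->.
- by case=> _ /noinl.
- by case=> _ H; case: (noinl _ _ _ _ (esym H)).
- by case=> -> /IH[-> -> ->].
Qed.

(** The languages [L] solve the equations of the grammar, and each word comes from one production
    with one factorization. This makes [L A] the language derived from [A] and rightmost derivations
    unique. *)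
Hypothesis L_sound : forall A beta ws,
  (A, beta) \in rules C -> factors L beta ws -> L A (flatten ws).

Hypothesis L_unique : forall A beta beta' ws ws',
  (A, beta) \in rules C -> (A, beta') \in rules C ->
  factors L beta ws -> factors L beta' ws' -> flatten ws = flatten ws' ->
  beta = beta' /\ ws = ws'.

Hypothesis L_greibach : forall A w, L A w ->
  (w = [::] /\ (A, [::]) \in rules C) \/
  exists a (ns : seq (nonterminal C)) ws,
    [/\ (A, inr a :: map inl ns) \in rules C, w = a :: flatten ws
      & factors L (map inl ns) ws].

(** Undoing a step merges the words parsed along the production into one word for its left-hand
    side. *)
Lemma factors_step_back s t ws : cfg_step s t -> factors L t ws ->
  exists2 ws', factors L s ws' & flatten ws' = flatten ws.
Proof.
move=> [A [beta [u [v [Hr -> ->]]]]].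
move=> /factors_catP[wu [wbv [-> Hu /factors_catP[wb [wv [-> Hb Hv]]]]]].
exists (wu ++ flatten wb :: wv); last by rewrite !flatten_cat.
by apply: factors_cat => //=; split=> //; apply: L_sound Hr Hb.
Qed.

Lemma derivation_factors s p w :
  path (fun s t => `[< cfg_step s t >]) s p -> last s p = terminal_form C w ->
  exists2 ws, factors L s ws & flatten ws = w.
Proof.
elim: p s => [|t p IH] s /=.
  move=> _ ->; exists [seq [:: a] | a <- w]; first exact: factors_terminal.
  exact: flatten_singletons.
case/andP=> /asboolP st pth /(IH _ pth) [ws Hws <-].
exact: factors_step_back st Hws.
Qed.

Let rm := fun s t : sform C => `[< rightmost_step s t >].

Lemma rightmost_path_step s p :
  path rm s p -> path (fun s t => `[< cfg_step s t >]) s p.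
Proof.
apply: sub_path => s1 s2 /asboolP[A [beta [u [v [H1 H2 H3]]]]]; apply/asboolP.
by exists A, beta, u, (terminal_form C v).
Qed.

Let rm_star s t := exists2 p, path rm s p & last s p = t.

Lemma rm_star_trans s t u : rm_star s t -> rm_star t u -> rm_star s u.
Proof.
move=> [p Hp <-] [q Hq <-]; exists (p ++ q); last by rewrite last_cat.
by rewrite cat_path Hp.
Qed.

(** A nonempty production starts with a terminal, so the words of its nonterminals are shorter than
    [w] and induction on the length applies. Expanding the nonterminals from right to left gives a
    rightmost derivation. *)
Lemma rm_complete n A w : size w < n -> L A w -> forall u v,
  rm_star (u ++ inl A :: terminal_form C v) (u ++ terminal_form C (w ++ v)).
Proof.
elim: n A w => // n IH A w wn /L_greibach[[-> Hr]|[a [ns [ws [Hr Ew Hws]]]]] u v.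
  exists [:: u ++ terminal_form C v] => //=; rewrite andbT; apply/asboolP.
  by exists A, [::], u, v.
have IHs ms ws' u' : size (flatten ws') < n -> factors L (map inl ms) ws' ->
    rm_star (u' ++ map inl ms ++ terminal_form C v)
            (u' ++ terminal_form C (flatten ws' ++ v)).
  elim: ms ws' u' => [|m ms IHm] [|w' ws'] u' //=; first by exists [::].
  rewrite size_cat => sz [Hw' Hws'].
  apply: (@rm_star_trans _ (u' ++ inl m :: terminal_form C (flatten ws' ++ v))).
    have:= IHm ws' (rcons u' (inl m)) _ Hws'; rewrite !cat_rcons; apply; lia.
  by rewrite -catA; apply: IH => //; lia.
apply: (@rm_star_trans _ (u ++ inr a :: map inl ns ++ terminal_form C v)).
  exists [:: u ++ inr a :: map inl ns ++ terminal_form C v] => //=.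
  by rewrite andbT; apply/asboolP; exists A, (inr a :: map inl ns), u, v.
rewrite Ew /= -!cat_rcons; apply: IHs => //.
by move: wn; rewrite Ew /=; lia.
Qed.

(** Both derivations first expand the rightmost nonterminal of [s], and what they derive from it is
    a block of [w] fixed by the unique parse of [s]. Unique factorization of this block fixes the
    production, and unique parsing passes on to the next form. *)
Lemma rm_unique p p' s w : path rm s p -> path rm s p' ->
  last s p = terminal_form C w -> last s p' = terminal_form C w ->
  (forall ws ws', factors L s ws -> factors L s ws' -> flatten ws = w ->
     flatten ws' = w -> ws = ws') ->
  p = p'.
Proof.
have stuck t : ~ rightmost_step (terminal_form C w) t.
  move=> [A [beta [u [v [_ + _]]]]].
  by elim: w u => [|a w' IHw] [|X u] //= [_] /IHw.
elim: p p' s => [|t p IH] [|t' p'] s //=.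
- by move=> _ /andP[/asboolP + _] Es; rewrite Es => /stuck.
- by move=> /andP[/asboolP + _] _ _ Es; rewrite Es => /stuck.
move=> /andP[/asboolP st pt] /andP[/asboolP st' pt'] lt lt' uniq_ws.
have [wt Hwt Ewt] := derivation_factors (rightmost_path_step pt) lt.
have [wt' Hwt' Ewt'] := derivation_factors (rightmost_path_step pt') lt'.
case: st => [A [beta [u [v [Hr Es Et]]]]].
case: st' => [A' [beta' [u' [v' [Hr' Es' Et']]]]].
have [? ? ?] := rightmost_form_inj (etrans (esym Es) Es'); subst u' A' v'.
have key b b' ws ws' : (A, b) \in rules C -> (A, b') \in rules C ->
    factors L (u ++ b ++ terminal_form C v) ws ->
    factors L (u ++ b' ++ terminal_form C v) ws' ->
    flatten ws = w -> flatten ws' = w -> b = b' /\ ws = ws'.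
  move=> Hb Hb' /factors_catP[wu [wbv [-> Hu /factors_catP[wb [wv [-> Hwb Hv]]]]]].
  move=> /factors_catP[wu' [wbv' [-> Hu' /factors_catP[wb' [wv' [-> Hwb' Hv']]]]]].
  rewrite !flatten_cat.
  move=> E E'; have := uniq_ws (wu ++ flatten wb :: wv) (wu' ++ flatten wb' :: wv').
  rewrite Es !flatten_cat /= => /(_ _ _ E E') Eww.
  have {Eww} : wu ++ flatten wb :: wv = wu' ++ flatten wb' :: wv'.
    by apply: Eww; apply: factors_cat => //=; split=> //;
      [apply: L_sound Hb Hwb | apply: L_sound Hb' Hwb'].
  move/eqP; rewrite eqseq_cat ?(factors_size Hu) ?(factors_size Hu') //.
  case/andP=> /eqP -> /eqP[fl ->].
  by have [-> ->] := L_unique Hb Hb' Hwb Hwb' fl.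
rewrite Et in Hwt; rewrite Et' in Hwt'.
have [Eb _] := key _ _ _ _ Hr Hr' Hwt Hwt' Ewt Ewt'.
have Ett : t' = t by rewrite Et Et' Eb.
rewrite Ett in pt' lt' *; congr (_ :: _). apply: (IH p' t) => // ws ws'.
rewrite Et => H1 H2 E1 E2; exact: (proj2 (key _ _ _ _ Hr Hr H1 H2 E1 E2)).
Qed.

Lemma greibach_language : cfg_language C = L (start C).
Proof.
apply/seteqP; split=> w.
  case=> p [pth lst]; have [[|w' [|? ?]] /= [] //] := derivation_factors pth lst.
  by move=> Lw _ <-; rewrite cats0.
move=> /(rm_complete (ltnSn _)) /(_ [::] [::]) [p pth].
rewrite /= cats0 => lst; exists p; split=> //; exact: rightmost_path_step.
Qed.

Lemma greibach_unambiguous : unambiguous_cfg C.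
Proof.
move=> w; rewrite greibach_language => Lw.
have [p pth] := rm_complete (ltnSn _) Lw [::] [::].
rewrite /= cats0 => lst; exists p; split=> // p' [pth' lst'].
apply: (rm_unique pth pth' lst lst') => -[|w1 [|? ?]] [|w2 [|? ?]] [] //= _ _ [] //.
by rewrite !cats0 => _ _ -> ->.
Qed.

End UnambiguousGrammars.

(** The nonterminals are the languages [Lang s], not the states: infinitely many states may share
    finitely many languages. The productions of a language are those of one representative state. *)
Lemma finite_states_grammar (S : finType) (St : Type) (valid : set St)
    (Lang : St -> set (seq S)) (Rule : St -> S -> seq (set (seq S)) -> Prop)
    (s0 : St) :
  valid s0 -> finite_set (Lang @` valid) ->
  (forall s a Ms, valid s -> Rule s a Ms ->
     size Ms <= 2 /\ forall M, M \in Ms -> (Lang @` valid) M) ->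
  (forall s a w, valid s -> Lang s (a :: w) <->
     exists Ms ws, [/\ Rule s a Ms, factors id (map inl Ms) ws
                     & flatten ws = w]) ->
  (forall s a Ms Ms' ws ws', valid s -> Rule s a Ms -> Rule s a Ms' ->
     factors id (map inl Ms) ws -> factors id (map inl Ms') ws' ->
     flatten ws = flatten ws' -> Ms = Ms' /\ ws = ws') ->
  unambiguous_context_free (Lang s0).
Proof.
move=> s0v /finite_seqP[Ls ELs] Rule_valid LangP Rule_unique.
pose N : finType := seq_sub Ls; pose L (A : N) : set (seq S) := ssval A.
have inLs s : valid s -> Lang s \in Ls.
  by move=> vs; have : (Lang @` valid) (Lang s) by [exists s]; rewrite ELs.
have /choice[rep repP] : forall A : N, exists s, valid s /\ Lang s = L A.
  move=> A; have := ssvalP A; rewrite /L => AL.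
  by have : [set` Ls] (ssval A) by []; rewrite -ELs => -[s vs <-]; exists s.
pose P (r : N * seq (N + S)) : Prop :=
  (r.2 = [::] /\ L r.1 [::]) \/
  exists a ns, r.2 = inr a :: map inl ns /\ Rule (rep r.1) a (map L ns).
(* At most two nonterminals follow the terminal, so the candidate productions form a finite list. *)
pose nss : seq (seq N) := [::] :: [seq [:: m] | m <- enum N] ++
  [seq [:: m; m'] | m <- enum N, m' <- enum N].
have nssP (ns : seq N) : size ns <= 2 -> ns \in nss.
  case: ns => [|m [|m' [|? ?]]] //= _; rewrite !inE ?eqxx //= mem_cat.
    by rewrite map_f // mem_enum.
  by apply/orP; right; apply/allpairsP; exists (m, m'); rewrite !mem_enum.
pose cands : seq (N * seq (N + S)) := [seq (A, [::]) | A <- enum N] ++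
  [seq (Ar.1, inr Ar.2 :: map inl ns) | Ar <- enum {: N * S}, ns <- nss].
pose R := [seq r <- cands | `[< P r >]].
have RP A beta : ((A, beta) \in R) <-> P (A, beta).
  rewrite mem_filter; split; first by case/andP => /asboolP.
  move=> PA; apply/andP; split; first exact/asboolP.
  rewrite mem_cat; case: PA => [[E _]|[a [ns [E HR]]]]; rewrite /= in E; rewrite {}E.
    by rewrite (map_f (fun A => (A, [::]))) // mem_enum.
  apply/orP; right.
  apply: (allpairs_f (fun Ar ns => (Ar.1, inr Ar.2 :: map inl ns))
            (x := (A, a))); first by rewrite mem_enum.
  have [sz _] := Rule_valid _ _ _ (proj1 (repP A)) HR.
  by apply: nssP; move: sz; rewrite size_map.
have s0N : Lang s0 \in Ls := inLs _ s0v.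
pose C := @Cfg S N (SeqSub s0N) R.
have factorsE (ns : seq N) ws :
    factors L (map inl ns : seq (N + S)) ws <-> factors id (map inl (map L ns)) ws.
  elim: ns ws => [|n ns IH] [|w ws] //=.
  by split=> -[? /IH ?].
have sound A beta ws : (A, beta) \in rules C -> factors L beta ws -> L A (flatten ws).
  move=> /RP[/= [-> LA]|/= [a [ns [-> HR]]]]; first by case: ws.
  case: ws => //= _ ws [-> /factorsE Hws]; have [vA <-] := repP A.
  by apply/(LangP _ _ _ vA); exists (map L ns), ws.
have uniqC A beta beta' ws ws' :
    (A, beta) \in rules C -> (A, beta') \in rules C ->
    factors L beta ws -> factors L beta' ws' -> flatten ws = flatten ws' ->
    beta = beta' /\ ws = ws'.
  move=> /RP[/= [-> LA]|/= [a [ns [-> HR]]]] /RP[/= [-> LA']|/= [a' [ns' [-> HR']]]].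
  - by case: ws => //; case: ws'.
  - by case: ws => //; case: ws' => //= _ ws' _ [-> _].
  - by case: ws' => //; case: ws => //= _ ws [-> _].
  case: ws => //= _ ws [-> /factorsE Hws]; case: ws' => //= _ ws' [-> /factorsE Hws'].
  case=> Ea Ew; subst a'; have [vA _] := repP A.
  have [Ens ->] := Rule_unique _ _ _ _ _ _ vA HR HR' Hws Hws' Ew.
  by split=> //; congr (_ :: map _ _); apply: inj_map Ens; apply: val_inj.
have greib A w : L A w ->
    (w = [::] /\ (A, [::]) \in rules C) \/
    exists a (ns : seq (nonterminal C)) ws,
    [/\ (A, inr a :: map inl ns) \in rules C, w = a :: flatten ws
      & factors L (map inl ns) ws].
  case: w => [|a w] LA; first by left; split=> //; apply/RP; left.
  right; have [vA EA] := repP A; move: (LA).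
  rewrite -EA => /(LangP _ _ _ vA) [Ms [ws [HR Hws <-]]].
  have [_ MsL] := Rule_valid _ _ _ vA HR.
  have [ns Ens] : exists ns : seq N, Ms = map L ns.
    elim: Ms MsL {HR Hws} => [|M Ms IH] MsL; first by exists [::].
    have [|ns ->] := IH; first by move=> M' HM'; apply: MsL; rewrite inE HM' orbT.
    have [|s vs EM] := MsL M; first by rewrite inE eqxx.
    have ML : M \in Ls by rewrite -EM inLs.
    by exists (SeqSub ML :: ns).
  exists a, ns, ws; rewrite Ens in HR Hws; split=> //; last exact/factorsE.
  by apply/RP; right; exists a, ns.
exists C; first exact: (greibach_unambiguous sound uniqC greib).
exact: (greibach_language sound greib).
Qed.

(** * Menger's theorem *)

Section Menger.

Variable V : eqType.
Implicit Types (A B S T : seq V) (r : rel V).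

Lemma walk_first (P : pred V) z p : has P (z :: p) ->
  exists p1 p2, [/\ p = p1 ++ p2, P (last z p1) & ~~ has P (belast z p1)].
Proof.
elim: p z => [|u p IH] z; first by rewrite /= orbF; exists [::], [::].
have [Pz _|nPz] := boolP (P z); first by exists [::], (u :: p).
rewrite /= (negPf nPz) /= => /IH[p1 [p2 [-> P1 nP]]].
by exists (u :: p1), p2; rewrite /= (negPf nPz).
Qed.

Lemma walk_last (P : pred V) z p : has P (z :: p) ->
  exists p1 p2, [/\ p = p1 ++ p2, P (last z p1) & ~~ has P p2].
Proof.
elim: p z => [|u p IH] z; first by rewrite /= orbF; exists [::], [::].
have [/IH[p1 [p2 [-> P1 nP]]] _|nPz] := boolP (has P (u :: p)).
  by exists (u :: p1), p2.
by rewrite /= orbC => /orP[/(negP nPz)//|Pz]; exists [::], (u :: p).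
Qed.

Lemma uniq_flatten_eq (ps : seq (seq V)) s s' z :
  uniq (flatten ps) -> s \in ps -> s' \in ps -> z \in s -> z \in s' -> s = s'.
Proof.
elim: ps => //= p ps IH; rewrite cat_uniq => /and3P[_ /hasPn dis uq].
rewrite !inE => /orP[/eqP->|sps] /orP[/eqP->|s'ps] // zs zs'; last exact: IH.
  have /dis/negP[//] : z \in flatten ps by apply/flattenP; exists s'.
have /dis/negP[//] : z \in flatten ps by apply/flattenP; exists s.
Qed.

Lemma uniq_flatten_uniq (ps : seq (seq V)) s :
  uniq (flatten ps) -> s \in ps -> uniq s.
Proof.
elim: ps => //= p ps IH; rewrite cat_uniq => /and3P[up _ uq].
by rewrite inE => /orP[/eqP->|/IH]; last apply.
Qed.

Lemma uniq_flatten_map (T : seq V) (f : V -> seq V) :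
  uniq T -> (forall t, t \in T -> uniq (f t)) ->
  (forall t t' z, t \in T -> t' \in T -> z \in f t -> z \in f t' -> t = t') ->
  uniq (flatten (map f T)).
Proof.
elim: T => //= t T IH /andP[tT uT] uf dis; rewrite cat_uniq uf ?mem_head //=.
rewrite IH //; first last.
- by move=> t1 t2 z h1 h2; apply: dis; rewrite inE ?h1 ?h2 orbT.
- by move=> t1 h1; apply: uf; rewrite inE h1 orbT.
rewrite andbT; apply/hasPn => z /flattenP[s /mapP[t' t'T ->] zt'].
apply/negP => zt; move: tT; rewrite (dis t t' z) ?mem_head ?t'T //.
by rewrite inE t'T orbT.
Qed.

Lemma uniq_flatten_index (ps : seq (seq V)) T (key : seq V -> V) :
  uniq (flatten ps) -> uniq T -> size T <= size ps ->
  (forall s, s \in ps -> key s \in s /\ key s \in T) ->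
  forall t, t \in T -> exists2 s, s \in ps & key s = t.
Proof.
move=> ufl uT szT keyP t tT.
have inj : {in ps &, injective key}.
  move=> s s' sps s'ps E; apply: (uniq_flatten_eq ufl sps s'ps (z := key s)).
    by case: (keyP s sps).
  by rewrite E; case: (keyP s' s'ps).
have ups : uniq ps.
  elim: ps ufl keyP {szT inj} => //= p ps IH; rewrite cat_uniq => /and3P[_ /hasPn h u] keyP.
  rewrite IH // ?andbT; last by move=> s sps; apply: keyP; rewrite inE sps orbT.
  apply/negP => pps; have [kp _] := keyP p (mem_head _ _).
  have /h/negP[//] : key p \in flatten ps by apply/flattenP; exists p.
have ukey : uniq (map key ps) by rewrite map_inj_in_uniq.
have sub : {subset map key ps <= T} by move=> _ /mapP[s sps ->]; case: (keyP s sps).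
have [|_ E] := uniq_min_size ukey sub; first by rewrite size_map.
by move: tT; rewrite -E => /mapP[s sps ->]; exists s.
Qed.

Definition link r A B (s : seq V) : bool :=
  if s is x :: p then [&& x \in A, path r x p & last x p \in B] else false.

Definition separates r A B S : Prop := forall s, link r A B s -> has (mem S) s.

Definition arcs (E : seq (V * V)) : rel V := fun x y => (x, y) \in E.

Lemma arcs_cons_path x y E z p : path (arcs ((x, y) :: E)) z p ->
  (x \notin belast z p) || (y \notin p) -> path (arcs E) z p.
Proof.
elim: p z => //= u p IH z /andP[]; rewrite /arcs inE => /orP[/eqP[-> ->]|zu] pth.
  by rewrite !inE !eqxx.
rewrite !inE !negb_or => H; apply/andP; split; first exact: zu.
by apply: IH => //; case/orP: H => /andP[_ ->]; rewrite ?orbT.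
Qed.

(** Induction on the arcs. If some [S] with fewer than [k] entries separates after removal of the
    arc [(x, y)], then [x :: S] and [y :: S] separate in the full graph, hence have exactly [k]
    entries. By induction there are [k] disjoint paths from [A] to [x :: S] and from [y :: S] to
    [B]; they are joined along [S] and the arc. *)
Lemma menger (E : seq (V * V)) A B k :
  (forall S, separates (arcs E) A B S -> k <= size S) ->
  exists ps, [/\ size ps = k, all (link (arcs E) A B) ps & uniq (flatten ps)].
Proof.
elim: E A B => [|[x y] E IH] A B kmin.
  have nopath z p : path (arcs [::]) z p -> p = [::] by case: p.
  pose S := undup [seq z <- A | z \in B].
  have Ssep : separates (arcs [::]) A B S.
    move=> [|z p] //= /and3P[zA /nopath -> /= zB].
    by rewrite mem_undup mem_filter zA zB.
  exists [seq [:: z] | z <- take k S]; split.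
  - by rewrite size_map size_takel // kmin.
  - apply/allP => s /mapP[z /mem_take]; rewrite mem_undup mem_filter => /andP[zB zA] ->.
    by rewrite /= zA zB.
  - have -> : forall s : seq V, flatten [seq [:: z] | z <- s] = s by elim=> //= a s ->.
    by rewrite take_uniq // undup_uniq.
have subE : subrel (arcs E) (arcs ((x, y) :: E)).
  by move=> u v; rewrite /arcs inE => ->; rewrite orbT.
have [kE|] := pselect (forall S, separates (arcs E) A B S -> k <= size S).
  have [ps [szps lps ups]] := IH A B kE; exists ps; split=> //.
  apply: sub_all lps => -[|z p] //= /and3P[-> pth ->].
  by rewrite (sub_path subE).
case/existsNP => S0 /not_implyP[S0sep /negP]; rewrite -ltnNge => S0k.
pose S := undup S0.
have uS : uniq S by exact: undup_uniq.
have Ssep : separates (arcs E) A B S.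
  by move=> s /S0sep /hasP[z zs /= zS]; apply/hasP; exists z; rewrite //= mem_undup.
have Sk : size S < k by apply: leq_ltn_trans S0k; exact: size_undup.
have xSsep : separates (arcs ((x, y) :: E)) A B (x :: S).
  move=> [|z p] // ls; have /and3P[zA pth lB] := ls; apply/negPn/negP => /hasPn nh.
  have /hasP[u /nh + uS'] : has (mem S) (z :: p); last by rewrite !inE (uS' : u \in S) orbT.
  apply: Ssep; rewrite /link zA lB andbT /=; apply: arcs_cons_path pth _.
  by apply/orP; left; apply/negP => /mem_belast/nh; rewrite !inE eqxx.
have ySsep : separates (arcs ((x, y) :: E)) A B (y :: S).
  move=> [|z p] // ls; have /and3P[zA pth lB] := ls; apply/negPn/negP => /hasPn nh.
  have /hasP[u /nh + uS'] : has (mem S) (z :: p); last by rewrite !inE (uS' : u \in S) orbT.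
  apply: Ssep; rewrite /link zA lB andbT /=; apply: arcs_cons_path pth _.
  by apply/orP; right; apply/negP => yp; have /nh := mem_behead (s := z :: p) yp; rewrite !inE eqxx.
have kS : k = (size S).+1.
  by apply/eqP; rewrite eqn_leq Sk andbT; exact: (kmin (x :: S)).
have xS : x \notin S.
  apply/negP => xS; have : k <= size S; last by rewrite kS ltnn.
  apply: kmin => s /xSsep /hasP[u us]; rewrite /= inE => uxS; apply/hasP; exists u => //=.
  by case/orP: uxS => [/eqP->|].
have yS : y \notin S.
  apply/negP => yS; have : k <= size S; last by rewrite kS ltnn.
  apply: kmin => s /ySsep /hasP[u us]; rewrite /= inE => uxS; apply/hasP; exists u => //=.
  by case/orP: uxS => [/eqP->|].
(* A path from [A] to [B], cut at its first vertex in [x :: S], does not use the arc. So what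
   separates [A] from [x :: S] in the smaller graph separates [A] from [B] in the full one. *)
have [|ps1 [sz1 l1 u1]] := IH A (x :: S).
  move=> T Tsep; apply: kmin => -[|z p] // ls.
  have /walk_first[p1 [p2 [Ep lp1 nb]]] := xSsep _ ls.
  have /and3P[zA pth lB] := ls; rewrite Ep cat_path in pth.
  have {Tsep} /(Tsep (z :: p1)) /hasP[v vp1 vT] : link (arcs E) A (x :: S) (z :: p1).
    apply/and3P; split; [exact: zA | | exact: lp1].
    case/andP: pth => pth _; apply: arcs_cons_path pth _.
    by apply/orP; left; apply: contra nb => xb; apply/hasP; exists x; rewrite // inE mem_head.
  by apply/hasP; exists v => //; rewrite Ep -cat_cons mem_cat vp1.
(* The mirror image: paths are cut at their last vertex in [y :: S]. *)
have [|ps2 [sz2 l2 u2]] := IH (y :: S) B.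
  move=> T Tsep; apply: kmin => -[|z p] // ls.
  have /walk_last[p1 [p2 [Ep lp1 nb]]] := ySsep _ ls.
  have /and3P[zA pth lB] := ls; rewrite Ep cat_path in pth.
  rewrite Ep last_cat in lB.
  have {Tsep} /(Tsep (last z p1 :: p2)) /hasP[v vp1 vT] :
      link (arcs E) (y :: S) B (last z p1 :: p2).
    apply/and3P; split; [exact: lp1 | | exact: lB].
    case/andP: pth => _ pth; apply: arcs_cons_path pth _.
    by apply/orP; right; apply: contra nb => xb; apply/hasP; exists y; rewrite // inE mem_head.
  apply/hasP; exists v => //; move: vp1; rewrite Ep -cat_cons mem_cat inE.
  by case/orP => [/eqP->|->]; rewrite ?mem_last ?orbT.
(* [f1 t] is the path from [A] that ends at [t]; [f2 t] will be the path to [B] that starts at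
   [t]. *)
have /boolp.choice[f1 f1P] : forall t, exists s,
    t \in x :: S -> s \in ps1 /\ last x s = t.
  move=> t; have [tS|] := boolP (t \in x :: S); last by exists [::].
  have [||s sps|s sps ls] := @uniq_flatten_index ps1 (x :: S) (last x) u1 _ _ _ t tS.
  - by rewrite /= xS.
  - by rewrite sz1 kS.
  - by have := allP l1 _ sps; case: s sps => [|z p] //= _ /and3P[_ _ ->]; rewrite mem_last.
  - by exists s.
have /boolp.choice[f2 f2P] : forall t, exists s,
    t \in y :: S -> s \in ps2 /\ head y s = t.
  move=> t; have [tS|] := boolP (t \in y :: S); last by exists [::].
  have [||s sps|s sps ls] := @uniq_flatten_index ps2 (y :: S) (head y) u2 _ _ _ t tS.
  - by rewrite /= yS.
  - by rewrite sz2 kS.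
  - by have := allP l2 _ sps; case: s sps => [|z p] //= _ /and3P[-> _ _]; rewrite mem_head.
  - by exists s.
have f1E t : t \in x :: S -> exists a p,
    [/\ f1 t = a :: p, a \in A, path (arcs E) a p, last a p = t & uniq (a :: p)].
  move=> /f1P[/[dup] fps /(allP l1) lf lt]; have := uniq_flatten_uniq u1 fps.
  by case: (f1 t) lf lt => [|a p] // /and3P[aA pth _] /= <-; exists a, p.
have f2E t : t \in y :: S -> exists p,
    [/\ f2 t = t :: p, path (arcs E) t p, last t p \in B & uniq (t :: p)].
  move=> /f2P[/[dup] fps /(allP l2) lf lt]; have := uniq_flatten_uniq u2 fps.
  by case: (f2 t) lf lt => [|a p] // /and3P[_ pth aB] /= <-; exists p.
have f1_dis t t' z : t \in x :: S -> t' \in x :: S -> z \in f1 t -> z \in f1 t' -> t = t'.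
  move=> /f1P[h1 E1] /f1P[h2 E2] z1 z2.
  by rewrite -E1 -[RHS]E2 (uniq_flatten_eq u1 h1 h2 z1 z2).
have f2_dis t t' z : t \in y :: S -> t' \in y :: S -> z \in f2 t -> z \in f2 t' -> t = t'.
  move=> /f2P[h1 E1] /f2P[h2 E2] z1 z2.
  by rewrite -E1 -[RHS]E2 (uniq_flatten_eq u2 h1 h2 z1 z2).
have f1S t z : t \in x :: S -> z \in f1 t -> z \in S -> z = t.
  move=> tS zt zS; have zxS : z \in x :: S by rewrite inE zS orbT.
  apply: (f1_dis z t z) => //; have [a [p [-> _ _ <- _]]] := f1E z zxS; exact: mem_last.
have f2S t z : t \in y :: S -> z \in f2 t -> z \in S -> z = t.
  move=> tS zt zS; have zxS : z \in y :: S by rewrite inE zS orbT.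
  by apply: (f2_dis z t z) => //; have [p [-> _ _ _]] := f2E z zxS; rewrite mem_head.
(* Two linked paths can only meet in the separator, else they would bypass it. *)
have meet t t' z : t \in x :: S -> t' \in y :: S -> z \in f1 t -> z \in f2 t' -> z \in S.
  move=> tS t'S z1 z2; apply/negPn/negP => zS.
  have [a [p [Ef1 aA pth lt un]]] := f1E t tS.
  have [q [Ef2 qth lB un']] := f2E t' t'S.
  rewrite Ef1 in z1; rewrite Ef2 in z2.
  case/splitPl: z1 pth lt un Ef1 => p1 p2 lp1 pth lt un Ef1.
  case/splitPl: z2 qth lB un' Ef2 => q1 q2 lq1 qth lB un' Ef2.
  have /hasP[u] : has (mem S) (a :: p1 ++ q2).
    apply: Ssep; apply/and3P; split=> //; last first.
      by move: lB; rewrite !last_cat lq1 lp1.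
    move: pth qth; rewrite !cat_path lp1 lq1 => /andP[-> _] /andP[_ ->] //.
  rewrite -cat_cons mem_cat /= => /orP[up1|uq2] uinS.
    have Eu : u = t by apply: f1S => //; rewrite Ef1 -cat_cons mem_cat up1.
    move: lt; rewrite last_cat lp1 => lt.
    have [Ep2|up2] := eqVneq p2 [::].
      by move: lt zS; rewrite Ep2 /= => ->; rewrite -Eu uinS.
    move: un; rewrite -cat_cons cat_uniq => /and3P[_ /hasPn /(_ t) h _].
    have /h : t \in p2 by move: up2 lt; case: (p2) => //= b p' _ <-; exact: mem_last.
    by rewrite /= -Eu up1.
  have Eu : u = t' by apply: f2S => //; rewrite Ef2 -cat_cons mem_cat uq2 orbT.
  move: un'; rewrite -cat_cons cat_uniq => /and3P[_ /hasPn /(_ u uq2) + _].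
  by rewrite Eu /= mem_head.
(* [sg] matches the ends in [x :: S] with the starts in [y :: S]. The path ending at [x] continues
   through the arc to [y]; any other end [t] also starts its continuation, where [behead] drops the
   repeated vertex. *)
pose sg t := if t == x then y else t.
have sgS t : t \in x :: S -> sg t \in y :: S.
  by rewrite /sg !inE; case: eqP => [_ _|_ /= ->]; rewrite ?eqxx ?orbT.
have sg_inj t t' : t \in x :: S -> t' \in x :: S -> sg t = sg t' -> t = t'.
  rewrite /sg !inE; case: eqP => [->|_] /= tS; case: eqP => [->|_] //= t'S E1.
    by move: yS; rewrite E1 t'S.
  by move: yS; rewrite -E1 tS.
pose g2 t := if t == x then f2 y else behead (f2 t).
have g2f2 t z : z \in g2 t -> z \in f2 (sg t).
  by rewrite /g2 /sg; case: eqP => // _; apply: mem_behead.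
pose h t := f1 t ++ g2 t.
have h_dis t t' z : t \in x :: S -> t' \in x :: S -> z \in h t -> z \in h t' -> t = t'.
  have cross t1 t2 : t1 \in x :: S -> t2 \in x :: S -> z \in f1 t1 -> z \in g2 t2 -> t1 = t2.
    move=> tS t'S z1 /g2f2 z2; have zS := meet _ _ _ tS (sgS _ t'S) z1 z2.
    have Ez : z = t1 by apply: f1S z1 zS.
    have := f2S _ _ (sgS _ t'S) z2 zS; rewrite /sg; case: eqP => [_|_ <-//] Ey.
    by move: yS; rewrite -Ey zS.
  move=> tS t'S; rewrite !mem_cat => /orP[z1|z1] /orP[z2|z2].
  - exact: f1_dis z1 z2.
  - exact: cross.
  - by apply/esym; apply: cross.
  - by apply: sg_inj => //; apply: f2_dis (g2f2 _ _ z1) (g2f2 _ _ z2); apply: sgS.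
exists [seq h t | t <- x :: S]; split.
- by rewrite size_map.
- apply/allP => s /mapP[t tS ->]; have [a [p [Ef1 aA pth lt un]]] := f1E t tS.
  rewrite /h Ef1 /g2 cat_cons; apply/and3P; split => //.
    rewrite cat_path (sub_path subE pth) /= lt; case: eqP => [->|/eqP tx].
      have [q [-> qth _ _]] := f2E y (mem_head _ _).
      by rewrite /= (sub_path subE qth) andbT /arcs mem_head.
    have [|q [-> qth _ _]] := f2E t.
      by move: tS; rewrite !inE (negPf tx) => /= ->; rewrite orbT.
    by rewrite /= (sub_path subE qth).
  rewrite last_cat lt; case: eqP => [->|/eqP tx].
    by have [q [-> _ lB _]] := f2E y (mem_head _ _).
  have [|q [-> _ lB _]] := f2E t; last by [].
    by move: tS; rewrite !inE (negPf tx) => /= ->; rewrite orbT.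
- apply: (@uniq_flatten_map (x :: S) h) => //; first by rewrite /= xS.
  move=> t tS; have [a [p [Ef1 _ _ _ un]]] := f1E t tS.
  have [q [Ef2 _ _ un2]] := f2E _ (sgS t tS).
  rewrite /h cat_uniq Ef1 un /=; apply/andP; split; last first.
    by move: Ef2 un2; rewrite /g2 /sg; case: eqP => _ -> //= /andP[].
  apply/hasPn => z z2; apply/negP => z1.
  rewrite -Ef1 in z1; have zS := meet _ _ _ tS (sgS _ tS) z1 (g2f2 _ _ z2).
  have Ez := f1S _ _ tS z1 zS; move: Ef2 un2 z2; rewrite /g2 /sg.
  case: eqP => [tx|_]; first by move: xS; rewrite -tx -Ez zS.
  by move=> -> /= /andP[+ _]; rewrite Ez => /negPf->.
Qed.
(** Reduces an infinite graph to finitely many paths. Take a path [s] avoiding [R]: a set [S] either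
    misses [s], or meets it in some [u] and is handled by the family for [u :: R], with [u] ranging
    over the finitely many vertices of [s]. *)
Lemma finite_hitting_family r A B k :
  (forall S, size S < k -> exists2 s, link r A B s & ~~ has (mem S) s) ->
  forall m R, size R + m < k -> exists2 ps, all (link r A B) ps &
    forall S, size S <= m -> exists2 s, s \in ps & ~~ has (mem (R ++ S)) s.
Proof.
move=> kmin; elim=> [|m IH] R Rk.
  have [|s ls Rs] := kmin R; first by rewrite addn0 in Rk.
  exists [:: s]; first by rewrite /= ls.
  by move=> [|//] _; exists s; rewrite ?mem_head // cats0.
have [|s ls Rs] := kmin R; first by lia.
have /boolp.choice[F FP] : forall u, exists ps, all (link r A B) ps /\
    forall S, size S <= m -> exists2 s, s \in ps & ~~ has (mem ((u :: R) ++ S)) s.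
  by move=> u; have [|ps ? ?] := IH (u :: R); [rewrite /=; lia | exists ps].
exists (s :: flatten (map F s)).
  rewrite /= ls; apply/allP => s' /flattenP[ps /mapP[u us ->]].
  by have [h _] := FP u; apply: (allP h).
move=> S Sm; have [/hasP[u us /= uS]|nS] := boolP (has (mem S) s); last first.
  exists s; first exact: mem_head.
  apply/hasPn => v vs; rewrite !inE mem_cat negb_or.
  by have /hasPn/(_ v vs)/= -> := Rs; have /hasPn/(_ v vs)/= -> := nS.
have [_ /(_ (rem u S))[|s' s'F nh]] := FP u.
  by rewrite size_rem //; lia.
exists s'; first by rewrite inE; apply/orP; right; apply/flattenP; exists (F u); rewrite ?map_f.
apply/hasPn => v /(hasPn nh); rewrite /= !(inE, mem_cat) !negb_or => /and3P[vu -> vr] /=.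
by apply: contra vr; rewrite (perm_mem (perm_to_rem uS)) inE (negPf vu).
Qed.

(** A finite family of paths that cannot all be hit by fewer than [k] vertices has finitely many
    arcs, and the finite theorem applies to these. *)
Lemma menger_rel r A B k :
  (forall S, size S < k -> exists2 s, link r A B s & ~~ has (mem S) s) ->
  exists ps, [/\ size ps = k, all (link r A B) ps & uniq (flatten ps)].
Proof.
case: k => [|k] kmin; first by exists [::].
have [|ps lps hit] := finite_hitting_family kmin (m := k) (R := [::]) _; first by [].
pose E := flatten [seq zip s (behead s) | s <- ps].
have Er : subrel (arcs E) r.
  move=> x y /flattenP[_ /mapP[s /(allP lps) ls ->]].
  case: s ls => // z p /and3P[_ + _]; elim: p z => //= u p IH z /andP[zu pth].
  by rewrite inE => /orP[/eqP[-> ->] //|]; apply: IH pth.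
have lE s : s \in ps -> link (arcs E) A B s.
  move=> sps; have := allP lps _ sps.
  have sE x y : (x, y) \in zip s (behead s) -> arcs E x y.
    by move=> xy; apply/flattenP; exists (zip s (behead s)) => //; apply/mapP; exists s.
  case: s sE {sps} => // z p sE /and3P[zA _ lB]; apply/and3P; split=> //.
  elim: p z sE {zA lB} => //= u p IH z sE; rewrite sE ?mem_head //=.
  by apply: IH => x y xy; apply: sE; rewrite inE xy orbT.
have [|qs [szq lq uq]] := @menger E A B k.+1.
  move=> S Ssep; rewrite ltnNge; apply/negP => /hit[s /lE/Ssep].
  by rewrite cat0s => ->.
exists qs; split=> //; apply: sub_all lq => -[|z p] // /and3P[zA pth lB].
by apply/and3P; split => //; apply: sub_path pth.
Qed.
End Menger.

(** * Maximal sets with two boundary vertices *)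

(** Bounding duplicate-free lists expresses finiteness and size at once, without an enumeration. *)
Definition atmost (V : eqType) (n : nat) (A : set V) : Prop :=
  forall s : seq V, uniq s -> (forall z, z \in s -> A z) -> size s <= n.

Lemma atmost_seq (V : eqType) n (A : set V) : atmost n A ->
  exists s : seq V, [/\ uniq s, size s <= n & A = [set` s]].
Proof.
move=> An; pose P k := `[< exists s : seq V, [/\ uniq s, size s = k & forall z, z \in s -> A z] >].
have exP : exists k, P k by exists 0; apply/asboolP; exists [::].
have Pn k : P k -> k <= n by move/asboolP => [s [us <- sA]]; exact: An.
have [k /asboolP[s [us sk sA]] kmax] := ex_maxnP exP Pn.
exists s; split=> //; first by exact: An.
apply/seteqP; split=> z; last exact: sA.
move=> Az; apply: contrapT => /negP zs.
have : P (size (z :: s)).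
  apply/asboolP; exists (z :: s); split=> //=; first by rewrite us zs.
  by move=> u; rewrite inE => /orP[/eqP->|/sA].
by move/kmax; rewrite /= sk ltnn.
Qed.

Section Boundaries.

Variables (V : choiceType) (e : rel V).
Hypothesis e_sym : symmetric e.
Implicit Types (A C D K : set V) (p s : seq V).

Definition reach A x y : Prop :=
  exists p, [/\ path e x p, last x p = y & forall z, z \in x :: p -> A z].

Definition conn C : Prop := forall x y, C x -> C y -> reach C x y.

Definition bd C : set V := [set z | ~ C z /\ exists2 y, C y & e y z].

Definition nbrs A : set V := [set z | exists2 y, A y & e y z].

Lemma reach_refl A x : A x -> reach A x x.
Proof. by move=> Ax; exists [::]; split=> // z; rewrite inE => /eqP->. Qed.

Lemma reach_edge A x y : A x -> A y -> e x y -> reach A x y.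
Proof.
move=> Ax Ay xy; exists [:: y]; split=> //=; first by rewrite xy.
by move=> z; rewrite !inE => /orP[] /eqP->.
Qed.

Lemma reach_trans A x y z : reach A x y -> reach A y z -> reach A x z.
Proof.
move=> [p [pth lp Ap]] [q [qth lq Aq]]; exists (p ++ q); split.
- by rewrite cat_path pth lp.
- by rewrite last_cat lp.
- move=> u; rewrite -cat_cons mem_cat => /orP[/Ap//|uq].
  by apply: Aq; rewrite inE uq orbT.
Qed.

Lemma reach_sym A x y : reach A x y -> reach A y x.
Proof.
move=> [p [pth lp Ap]]; exists (rev (belast x p)); split.
- by rewrite -lp rev_path (eq_path (e' := e)) // => u v; rewrite /= e_sym.
- by case: p pth lp Ap => [|u p] //= _ _ _; rewrite rev_cons last_rcons.
- move=> z; rewrite -lp -mem_rev rev_cons revK -lastI; exact: Ap.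
Qed.

Lemma reach_sub A B x y : A `<=` B -> reach A x y -> reach B x y.
Proof. by move=> AB [p [pth lp Ap]]; exists p; split=> // z /Ap/AB. Qed.

Lemma reach_in A x y : reach A x y -> A x /\ A y.
Proof.
by move=> [p [pth <- Ap]]; split; apply: Ap; rewrite ?mem_head ?mem_last.
Qed.

Lemma walk_exit A x p : path e x p -> A x -> ~ A (last x p) ->
  exists p1 z p2, [/\ p = p1 ++ z :: p2, forall u, u \in x :: p1 -> A u & bd A z].
Proof.
elim: p x => [|u p IH] x //= /andP[xu pth] Ax nA.
have [Au|nAu] := pselect (A u).
  have [p1 [z [p2 [-> Ap1 bz]]]] := IH u pth Au nA.
  exists (u :: p1), z, p2; split=> // v; rewrite inE => /orP[/eqP->//|]; exact: Ap1.
exists [::], u, p; split=> //; first by move=> v; rewrite inE => /eqP->.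
by split=> //; exists x.
Qed.

Lemma conn_exit C D x y : conn D -> D x -> C x -> D y -> ~ C y ->
  exists2 z, D z & bd C z.
Proof.
move=> cD Dx Cx Dy nCy; have [p [pth lp Dp]] := cD x y Dx Dy.
have [|p1 [z [p2 [Ep _ bz]]]] := walk_exit pth Cx _; first by rewrite lp.
by exists z => //; apply: Dp; rewrite Ep inE mem_cat mem_head !orbT.
Qed.

Lemma conn_subset C D x : conn D -> D x -> C x ->
  (forall z, D z -> ~ bd C z) -> D `<=` C.
Proof.
move=> cD Dx Cx h y Dy; apply: contrapT => nCy.
by have [z /h] := conn_exit cD Dx Cx Dy nCy.
Qed.

Lemma conn_through C x : (forall y, C y -> reach C x y) -> conn C.
Proof. by move=> h y z /h/reach_sym hy /h; apply: reach_trans. Qed.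

Lemma conn_setU_edge C D x y : conn C -> conn D -> C x -> D y -> e x y ->
  conn (C `|` D).
Proof.
move=> cC cD Cx Dy xy; apply: (@conn_through _ x) => z [Cz|Dz].
  by apply: reach_sub (cC x z Cx Cz) => ?; left.
apply: (@reach_trans _ _ y); first by apply: reach_edge => //; [left|right].
by apply: reach_sub (cD y z Dy Dz) => ?; right.
Qed.

Lemma conn_component A x : conn [set y | reach A x y].
Proof.
apply: (@conn_through _ x) => y [p [pth lp Ap]]; exists p; split=> // z zp.
case/splitPl: zp pth Ap {lp} => p1 p2 lp1; rewrite cat_path => /andP[pth _] Ap.
by exists p1; split=> // u up; apply: Ap; rewrite -cat_cons mem_cat up.
Qed.

Lemma bd_component A x z : bd [set y | reach A x y] z -> ~ A z.
Proof.
move=> [nz [y xy yz]] Az; apply: nz; apply: (reach_trans xy).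
by apply: reach_edge => //; case: (reach_in xy).
Qed.

(** A walk leaving [C] must cross [bd C]. So a connected set is recovered from its boundary and one
    vertex, which later bounds the number of cones. *)
Lemma conn_componentE C x : conn C -> C x ->
  C = [set y | reach (~` bd C) x y].
Proof.
move=> cC Cx; apply/seteqP; split=> y.
  by move=> Cy; apply: reach_sub (cC x y Cx Cy) => z Cz [].
move=> [p [pth <- bp]]; apply: contrapT => nC.
have [p1 [z [p2 [Ep _ bz]]]] := walk_exit pth Cx nC.
by apply: (bp z) => //; rewrite Ep inE mem_cat mem_head !orbT.
Qed.

Definition kcone K C : Prop :=
  [/\ C !=set0, conn C, forall z, C z -> ~ K z & atmost 2 (bd C)].

(** The largest [K]-cone through [v], or the empty set if [v] is in [part K]. *)
Definition piece K v : set V := [set w | exists C, [/\ kcone K C, C v & C w]].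

Definition part K : set V := [set v | ~ exists C, kcone K C /\ C v].

(** The union absorbs [y] from the boundary of [C] and [x] from that of [D], so each of the two
    contributes at most one vertex to the new boundary. *)
Lemma kcone_touch K C D x y : kcone K C -> kcone K D ->
  C x -> bd D x -> D y -> bd C y -> kcone K (C `|` D).
Proof.
move=> [C0 cC CK bC] [D0 cD DK bD] Cx bDx Dy bCy; split.
- by exists x; left.
- have [nDx [z Dz zx]] := bDx.
  by apply: (@conn_setU_edge _ _ x z) => //; rewrite e_sym.
- by move=> z [/CK|/DK].
- move=> s us sb.
  have sN z : z \in s -> ~ C z /\ ~ D z.
    by move=> /sb[h _]; split=> h'; apply: h; [left|right].
  pose inC z := `[< bd C z >]; pose inD z := `[< bd D z >].
  have sCD z : z \in s -> inC z || inD z.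
    move=> zs; have [nC nD] := sN z zs; have [_ [u [Cu|Du] uz]] := sb z zs.
      by apply/orP; left; apply/asboolP; split=> //; exists u.
    by apply/orP; right; apply/asboolP; split=> //; exists u.
  have szC : size [seq z <- s | inC z] <= 1.
    rewrite -ltnS; apply: (bC (y :: [seq z <- s | inC z])).
      rewrite /= filter_uniq // andbT mem_filter negb_and; apply/orP; right.
      by apply/negP => /sN[].
    by move=> z; rewrite inE mem_filter => /orP[/eqP->//|/andP[/asboolP]].
  have szD : size [seq z <- s | inD z] <= 1.
    rewrite -ltnS; apply: (bD (x :: [seq z <- s | inD z])).
      rewrite /= filter_uniq // andbT mem_filter negb_and; apply/orP; right.
      by apply/negP => /sN[].
    by move=> z; rewrite inE mem_filter => /orP[/eqP->//|/andP[/asboolP]].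
  have : size s <= size [seq z <- s | inC z] + size [seq z <- s | inD z].
    rewrite !size_filter -count_predUI -[X in X <= _]addn0 leq_add //.
    by rewrite (eq_in_count (a2 := predT)) ?count_predT // => z /sCD.
  by move=> h; apply: leq_trans h _; rewrite -[2]/(1 + 1) leq_add.
Qed.

(** Unless one set contains the other, each contains a boundary vertex of the other, and they
    touch. *)
Lemma kcone_setU K C D x : kcone K C -> kcone K D -> C x -> D x ->
  kcone K (C `|` D).
Proof.
move=> kC kD Cx Dx; have [_ cC _ _] := kC; have [_ cD _ _] := kD.
have [CD|] := pselect (C `<=` D); first by rewrite setUidr.
have [DC _|] := pselect (D `<=` C); first by rewrite setUidl.
move=> /existsNP[y /not_implyP[Dy nCy]] /existsNP[z /not_implyP[Cz nDz]].
have [v Dv bCv] := conn_exit cD Dx Cx Dy nCy.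
have [u Cu bDu] := conn_exit cC Cx Dx Cz nDz.
exact: kcone_touch kC kD Cu bDu Dv bCv.
Qed.

Lemma piece_self K v : ~ part K v -> piece K v v.
Proof. by move=> /contrapT[C [kC Cv]]; exists C. Qed.

Lemma kcone_sub_piece K C v : kcone K C -> C v -> C `<=` piece K v.
Proof. by move=> kC Cv w Cw; exists C. Qed.

Lemma piece_sub_part K v w : piece K v w -> ~ part K w.
Proof. by move=> [C [kC _ Cw]]; apply; exists C. Qed.

Lemma piece_kcone K v : ~ part K v -> kcone K (piece K v).
Proof.
move=> nv; split.
- by exists v; apply: piece_self.
- apply: (@conn_through _ v) => y [C [kC Cv Cy]]; have [_ cC _ _] := kC.
  by apply: reach_sub (cC v y Cv Cy); apply: kcone_sub_piece.
- by move=> z [C [[_ _ CK _] _ Cz]]; exact: CK.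
- move=> s us sb.
  (* Any finite list of boundary vertices of the piece already lies in the boundary of a single
     [K]-cone through [v], a finite union of such cones; so the bound two holds for the piece. *)
  have [C [kC Cv Cs]] : exists C, [/\ kcone K C, C v & forall z, z \in s -> bd C z].
    elim: s sb {us} => [|z s IH] sb.
      by have [C [kC Cv _]] := piece_self nv; exists C.
    have [|C [kC Cv Cs]] := IH; first by move=> u us; apply: sb; rewrite inE us orbT.
    have [nz [y [D [kD Dv Dy]] yz]] := sb z (mem_head _ _).
    have kCD := kcone_setU kC kD Cv Dv; exists (C `|` D); split=> //; first by left.
    move=> u uzs; have [nu _] := sb u uzs.
    have nCDu : ~ (C `|` D) u by move=> h; apply: nu; exists (C `|` D); split=> //; left.
    split=> //; move: uzs; rewrite inE => /orP[/eqP->|/Cs[_ [w Cw wu]]].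
      by exists y => //; right.
    by exists w => //; left.
  by have [_ _ _ bC] := kC; apply: bC.
Qed.

Lemma piece_eq K v w : piece K v w -> piece K w = piece K v.
Proof.
move=> vw; have vw' : piece K w v by case: vw => C [? ? ?]; exists C.
suff h a b : piece K a b -> piece K b `<=` piece K a by apply/seteqP; split; apply: h.
move=> ab u [C [kC Cb Cu]]; have nb : ~ part K b := piece_sub_part ab.
have [D [kD Da Db]] := ab; have kCD := kcone_setU kC kD Cb Db.
by exists (C `|` D); split=> //; [right|left].
Qed.

(** If [x] lay in a piece, the two adjacent pieces would have a [K]-cone as union, against
    maximality. *)
Lemma bd_piece_part K v x : ~ part K v -> bd (piece K v) x -> part K x.
Proof.
move=> nv bx; apply: contrapT => nx.
have kv := piece_kcone nv; have kx := piece_kcone nx.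
have [nvx [y vy yx]] := bx.
have nxy : ~ piece K x y.
  move=> xy; apply: nvx; rewrite -(piece_eq vy) (piece_eq xy); exact: piece_self.
have kU : kcone K (piece K v `|` piece K x).
  apply: (kcone_touch (x := y) (y := x)) => //; last exact: piece_self.
  by split=> //; exists x; [exact: piece_self | rewrite e_sym].
apply: nvx; exists (piece K v `|` piece K x); split=> //.
  by left; apply: piece_self.
by right; apply: piece_self.
Qed.

Hypothesis e_lf : locally_finite e.

Lemma finite_nbrs A : finite_set A -> finite_set (nbrs A).
Proof.
move=> fA; have -> : nbrs A = \bigcup_(x in A) [set y | e x y].
  by apply/seteqP; split=> z [y Ay yz]; exists y.
exact: bigcup_finite.
Qed.

Lemma finite_atmost n A : atmost n A -> finite_set A.
Proof. by move=> /atmost_seq[s [_ _ ->]]; apply/finite_seqP; exists s. Qed.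

End Boundaries.

(** * Disjoint rays *)

Section Rays.

Variables (V : choiceType) (e : rel V).
Hypothesis e_sym : symmetric e.
Hypothesis e_lf : locally_finite e.
Implicit Types (A C D K Z : set V) (p s : seq V).

(** * Large sets with boundary of minimal size *)

Section LargeSets.

Variable P : set V.

Definition large D : Prop :=
  [/\ conn e D, finite_set (bd e D) & infinite_set (D `&` P)].

Definition bdsize C n : Prop :=
  exists s, [/\ uniq s, size s = n & bd e C = [set` s]].

(** The size of the boundary cannot drop inside [C]; Menger's theorem turns this into disjoint
    paths. *)
Definition tight C : Prop := large C /\
  forall C' n n', C' `<=` C -> large C' -> bdsize C n -> bdsize C' n' -> n <= n'.

Lemma finite_bdsize C : finite_set (bd e C) -> exists n, bdsize C n.
Proof.
move=> /finite_seqP[s Es]; exists (size (undup s)), (undup s).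
by split; rewrite ?undup_uniq // Es; apply/seteqP; split=> z /=; rewrite mem_undup.
Qed.

Lemma large_point C : large C -> exists2 c, C c & P c.
Proof.
move=> [_ _ inf]; apply: contrapT => no; apply: inf.
rewrite (_ : _ `&` _ = set0) //; apply/seteqP; split=> // z [Cz Pz].
by case: no; exists z.
Qed.

(** If the connected set [D] meets [Z], every component of [D] minus [Z] contains a neighbour of
    [Z]. By local finiteness there are finitely many components, so one of them has infinitely many
    vertices in [P]. *)
Lemma large_avoid D Z : large D -> finite_set Z ->
  exists D', [/\ D' `<=` D, large D' & forall z, D' z -> ~ Z z].
Proof.
move=> lD fZ; have [cD fD iD] := lD.
have [[z0 [Dz0 Zz0]]|no] := pselect (exists z, D z /\ Z z); last first.
  by exists D; split=> // z Dz Zz; apply: no; exists z.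
pose A := D `\` Z; pose comp n := [set y | reach e A n y].
have cover v : A v -> exists2 n, nbrs e Z n & comp n v.
  move=> Av; have [Dv _] := Av; have [q [pth lq Dq]] := cD v z0 Dv Dz0.
  have [||p1 [z [p2 [Eq _ bz]]]] := walk_exit (A := comp v) pth.
  - exact: reach_refl.
  - by rewrite lq => h; have [_ [_ ]] := reach_in h.
  have nAz := bd_component bz; have [_ [y vy yz]] := bz.
  have Zz : Z z.
    apply: contrapT => nZ; apply: nAz; split=> //; apply: Dq.
    by rewrite Eq inE mem_cat mem_head !orbT.
  exists y; last exact: reach_sym.
  by exists z; rewrite // e_sym.
have [[n Nn infn]|fin] := pselect (exists2 n, nbrs e Z n & infinite_set (comp n `&` P)).
  have sub : comp n `<=` A by move=> v h; have [] := reach_in h.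
  exists (comp n); split; [by move=> v /sub[]| |by move=> v /sub[]].
  split=> //; first exact: conn_component.
  apply: (@sub_finite_set _ _ (bd e D `|` Z)); last by rewrite finite_setU.
  move=> z bz; have nAz := bd_component bz; have [_ [y /sub[Dy _] yz]] := bz.
  have [Zz|nZ] := pselect (Z z); first by right.
  by left; split; [move=> Dz; apply: nAz | exists y].
case: iD; apply: (@sub_finite_set _ _ (Z `|` \bigcup_(n in nbrs e Z) (comp n `&` P))).
  move=> v [Dv Pv]; have [Zv|nZ] := pselect (Z v); first by left.
  by right; have [|n Nn nv] := cover v; [split | exists n].
rewrite finite_setU; split=> //; apply: bigcup_finite; first exact: finite_nbrs.
by move=> n Nn; apply: contrapT => inf; apply: fin; exists n.
Qed.

(** Among the large subsets of [D] off [Z'], one with least boundary is tight, since its own large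
    subsets compete too. The neighbours of [Z] are put in [Z'] to keep the boundary off [Z]. *)
Lemma tight_avoid D Z : large D -> finite_set Z ->
  exists C, [/\ C `<=` D, tight C & forall z, C z \/ bd e C z -> ~ Z z].
Proof.
move=> lD fZ; pose Z' := Z `|` nbrs e Z.
have fZ' : finite_set Z' by rewrite finite_setU; split=> //; exact: finite_nbrs.
pose good C := [/\ C `<=` D, large C & forall z, C z -> ~ Z' z].
pose Q n := `[< exists2 C, good C & bdsize C n >].
have exQ : exists n, Q n.
  have [C gC] := large_avoid lD fZ'; have [_ [_ fC _] _] := gC.
  by have [n bn] := finite_bdsize fC; exists n; apply/asboolP; exists C.
have [m /asboolP[C [CD lC CZ] Cm] mmin] := ex_minnP exQ.
exists C; split=> //.
- split=> // C' n n' C'C lC' bn bn'.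
  have -> : n = m.
    move: bn Cm => [s [us <- Es]] [s' [us' <- Es']]; apply: perm_size.
    apply: uniq_perm => // z; have := congr1 (fun A => A z) (etrans (esym Es) Es').
    by move=> /= E; apply/idP/idP; rewrite E.
  apply: mmin; apply/asboolP; exists C' => //; split=> //.
    exact: subset_trans CD.
  by move=> z /C'C/CZ.
- move=> z [/CZ h Zz|[_ [y /CZ h yz]] Zz]; apply: h; first by left.
  by right; exists z; rewrite // e_sym.
Qed.

(* A separator smaller than the boundary of a tight set would bound a large subset. *)
Lemma tight_linkage C C' : tight C -> large C' -> C' `<=` C ->
  (forall z, C' z \/ bd e C' z -> ~ bd e C z) ->
  exists f : V -> seq V, forall t, bd e C t ->
    [/\ path e t (f t), bd e C' (last t (f t)), uniq (f t),
        forall z, z \in f t -> C z /\ ~ C' z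
      & forall t' z, bd e C t' -> z \in f t -> z \in f t' -> t = t'].
Proof.
move=> [lC Cmin] lC' C'C dis; have [cC fC _] := lC; have [cC' fC' iC'] := lC'.
have [n [s [us sn Es]]] := finite_bdsize fC.
have [n' [s' [us' sn' Es']]] := finite_bdsize fC'.
have [c C'c _] := large_point lC'.
(* All vertices of an [r]-path after its first one lie in [C] outside [C']. *)
pose r x y := e x y && `[< C y /\ ~ C' y >].
have [|ps [szps lps ups]] := @menger_rel V r s s' (size s).
  move=> S Sn; apply: contrapT => noS.
  (* [D] below is the component of [C] minus [S'] around [C']. If every path meets [S], the boundary
     of [D] lies in [S'] and is too small for the tight set [C]. *)
  pose S' := [seq z <- S | ~~ `[< C' z >]]; pose A := C `\` [set` S'].
  have C'A : C' `<=` A.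
    by move=> z C'z; split; [exact: C'C|]; rewrite /= mem_filter => /andP[/asboolPn].
  pose D := [set y | reach e A c y].
  have DC : D `<=` C by move=> z h; have [_ []] := reach_in h.
  have C'D : C' `<=` D by move=> z C'z; apply: reach_sub (cC' c z C'c C'z).
  have bD z : bd e D z -> z \in S'.
    move=> bz; have nAz := bd_component bz; have [_ [y Dy yz]] := bz.
    apply/negPn/negP => /negP zS'.
    have nCz : ~ C z by move=> Cz; apply: nAz.
    have bCz : bd e C z by split=> //; exists y => //; apply: DC.
    have nC'y : ~ C' y.
      move=> C'y; apply: (dis z) => //; right; split; last by exists y.
      by move=> /C'C.
    (* The walk from [y] through [D], stopped just before [C'] and preceded by [z], is a linking
       path that avoids [S]. *)
    have [q [pth lq Aq]] := reach_sym e_sym Dy.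
    have [//||p1 [u [p2 [Eq nC'p1 [nnC'u _]]]]] := walk_exit (A := ~` C') pth.
      by rewrite lq => /(_ C'c).
    have C'u : C' u by apply: contrapT.
    move: pth; rewrite Eq cat_path /= => /and3P[pth1 p1u _].
    have inp v : v \in y :: p1 -> A v /\ ~ C' v.
      move=> vp; split; last exact: nC'p1.
      by apply: Aq; rewrite Eq -cat_cons mem_cat vp.
    apply: noS; exists (z :: y :: p1).
      apply/and3P; split.
      - by have : [set` s] z by rewrite -Es.
      - rewrite /= {1}/r e_sym yz /=; apply/andP; split.
          by apply/asboolP; split=> //; apply: DC.
        have : all [pred v | `[< C v /\ ~ C' v >]] p1.
          apply/allP => v vp; apply/asboolP; have [|[Cv _] nC'v] := inp v.
            by rewrite inE vp orbT.
          by split.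
        elim: p1 y pth1 {Dy yz nC'y q lq Aq Eq nC'p1 p1u inp} => //= v p1 IH y.
        by rewrite /r => /andP[-> /IH h] /andP[-> /h].
      - have : bd e C' (last y p1).
          split; last by exists u; rewrite // e_sym.
          by case: (inp (last y p1)); rewrite ?mem_last.
        by rewrite Es'.
    apply/hasPn => v; rewrite inE => /orP[/eqP->|/inp[[Cv nS'v] nC'v]]; apply/negP => vS.
      by apply: zS'; rewrite mem_filter; apply/andP; split=> //; apply/asboolPn => /C'C.
    by apply: nS'v; rewrite /= mem_filter; apply/andP; split=> //; apply/asboolPn.
  have lD : large D.
    split; first exact: conn_component.
      by apply: (@sub_finite_set _ _ [set` S']); [exact: bD | apply/finite_seqP; exists S'].
    move=> fD; apply: iC'; apply: sub_finite_set fD => z [/C'D Dz Pz]; by split.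
  pose sD := [seq z <- undup S' | `[< bd e D z >]].
  have bsD : bdsize D (size sD).
    exists sD; split=> //; first by rewrite filter_uniq ?undup_uniq.
    apply/seteqP; split=> z /=; rewrite mem_filter mem_undup.
      by move=> bz; apply/andP; split; [apply/asboolP | apply: bD].
    by case/andP=> /asboolP.
  have : size s <= size sD by apply: (Cmin D _ _ DC lD _ bsD); exists s.
  rewrite leqNgt => /negP; apply; apply: leq_ltn_trans Sn.
  apply: leq_trans (size_subseq (filter_subseq _ _)) _.
  apply: leq_trans (size_undup _) _.
  by rewrite size_filter count_size.
have /boolp.choice[f fP] : forall t, exists p, t \in s -> (t :: p) \in ps.
  move=> t; have [ts|] := boolP (t \in s); last by exists [::].
  have [||q qps qt] := @uniq_flatten_index _ ps s (head c) ups us _ _ t ts.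
  - by rewrite szps.
  - by move=> q qps; have := allP lps q qps; case: (q) => // z p /and3P[zs _ _]; rewrite mem_head.
  - by exists (behead q) => _; have := allP lps q qps; case: q qps qt => [|z p] qps <-.
exists f => t; rewrite Es /= => ts; have tps := fP t ts.
have /and3P[_ pth lB] := allP lps _ tps.
have rp : path e t (f t) by apply: sub_path pth => x y /andP[].
split=> //.
- by rewrite Es'.
- by have /= /andP[] := uniq_flatten_uniq ups tps.
- move: {rp lB tps} (f t) {1}t pth; rewrite /r; elim=> [|v p IH] x //=.
  move=> /andP[/andP[_ /asboolP Cv] pth] z.
  by rewrite inE => /orP[/eqP->//|]; apply: IH pth z.
move=> t' z; rewrite /= => t's zt zt'; have t'ps := fP t' t's.
have := uniq_flatten_eq ups tps t'ps (z := z).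
by rewrite !inE zt zt' !orbT => /(_ isT isT) [].
Qed.

Hypothesis e_conn : connected_off e set0.

(** [F] chooses inside each tight set another one with disjoint boundary; the linkages between
    consecutive boundaries concatenate to disjoint rays. *)
Lemma tight_rays C0 t0 : tight C0 -> bd e C0 t0 ->
  exists (C : nat -> set V) (r : V -> nat -> V),
  [/\ forall n, conn e (C n),
      forall A, finite_set A -> exists n, forall z, A z -> ~ C n z,
      forall t, bd e C0 t -> ray e (r t),
      forall t n, bd e C0 t -> exists m, forall k, m <= k -> C n (r t k)
    & forall t t' i j, bd e C0 t -> bd e C0 t' -> r t i = r t' j -> t = t'].
Proof.
move=> tC0 bt0.
have /boolp.choice[F FP] : forall C, exists C', tight C ->
    [/\ tight C', C' `<=` C & forall z, C' z \/ bd e C' z -> ~ bd e C z].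
  move=> C; have [tC|] := pselect (tight C); last by exists C.
  have [lC _] := tC; have [_ fC _] := lC.
  by have [C' [? ? ?]] := tight_avoid lC fC; exists C'.
pose C n := iter n F C0.
have tC n : tight (C n) by elim: n => //= n /FP[].
have CS n : C n.+1 `<=` C n by have [] := FP _ (tC n).
have Cdis n z : C n.+1 z \/ bd e (C n.+1) z -> ~ bd e (C n) z.
  by have [_ _] := FP _ (tC n); apply.
have Cmono n m : n <= m -> C m `<=` C n.
  elim: m => [|m IH]; first by rewrite leqn0 => /eqP->.
  by rewrite leq_eqVlt => /orP[/eqP->//|/IH h] z /CS/h.
have /boolp.choice[g gP] : forall n, exists f : V -> seq V, forall t, bd e (C n) t ->
    [/\ path e t (f t), bd e (C n.+1) (last t (f t)), uniq (f t),
        forall z, z \in f t -> C n z /\ ~ C n.+1 z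
      & forall t' z, bd e (C n) t' -> z \in f t -> z \in f t' -> t = t'].
  by move=> n; apply: tight_linkage => //; [case: (tC n.+1) | exact: Cdis].
(* The first [n] links followed from [t], without [t] itself. *)
pose W t := fix W n : seq V := if n is m.+1 then W m ++ g m (last t (W m)) else [::].
have Wlast t n : bd e C0 t -> bd e (C n) (last t (W t n)).
  by move=> bt; elim: n => //= n IH; rewrite last_cat; have [] := gP n _ IH.
have Wpath t n : bd e C0 t -> path e t (W t n).
  move=> bt; elim: n => //= n IH; rewrite cat_path IH /=.
  by have [] := gP n _ (Wlast t n bt).
have WnC t n z : bd e C0 t -> z \in t :: W t n -> ~ C n z.
  move=> bt; elim: n => [|n IH].
    by rewrite inE => /eqP->; case: bt.
  rewrite -[W t n.+1]/(W t n ++ _) -cat_cons mem_cat => /orP[/IH h /CS//|zg].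
  by have [_ _ _ /(_ z zg)[]] := gP n _ (Wlast t n bt).
have Wuniq t n : bd e C0 t -> uniq (t :: W t n).
  move=> bt; elim: n => // n IH.
  have [_ _ ug gC _] := gP n _ (Wlast t n bt).
  rewrite -[W t n.+1]/(W t n ++ _) -cat_cons cat_uniq IH ug andbT /=.
  by apply/hasPn => z /gC[Cz _]; apply/negP => /(WnC t n z bt).
have Wsize t n : bd e C0 t -> n <= size (W t n).
  move=> bt; elim: n => //= n IH; rewrite size_cat -addn1 leq_add // lt0n.
  apply/negP => /nilP Eg; have [_ + _ _ _] := gP n _ (Wlast t n bt).
  by rewrite Eg /= => bl; apply: (Cdis n (last t (W t n))); [right | exact: Wlast].
have Wcat t n m : bd e C0 t -> n <= m ->
    exists2 R, W t m = W t n ++ R & forall z, z \in R -> C n z.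
  move=> bt; elim: m => [|m IH]; first by rewrite leqn0 => /eqP->; exists [::].
  rewrite leq_eqVlt => /orP[/eqP->|nm]; first by exists [::]; rewrite ?cats0.
  have [R ER RC] := IH nm; exists (R ++ g m (last t (W t m))).
    by rewrite catA -ER.
  move=> z; rewrite mem_cat => /orP[/RC//|zg].
  by have [_ _ _ /(_ z zg)[/(Cmono n m nm)]] := gP m _ (Wlast t m bt).
(* Every link has at least one vertex, so [W t k] reaches index [k], and longer walks agree with it
   there. *)
pose r t k := nth t (t :: W t k) k.
have rE t k n : bd e C0 t -> k <= size (W t n) -> r t k = nth t (t :: W t n) k.
  move=> bt kn; rewrite /r; case: (leqP n k) => nk.
    by have [R -> _] := Wcat t n k bt nk; rewrite -cat_cons nth_cat /= ltnS kn.
  have [R -> _] := Wcat t k n bt (ltnW nk).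
  by rewrite -cat_cons nth_cat /= ltnS Wsize.
have Wdis t t' n z : bd e C0 t -> bd e C0 t' -> t <> t' ->
    z \in t :: W t n -> z \in t' :: W t' n -> False.
  move=> bt bt' tt'; elim: n z => [|n IH] z.
    by rewrite !inE => /eqP-> /eqP.
  have lastne : last t (W t n) <> last t' (W t' n).
    move=> E; apply: (IH (last t (W t n))); first exact: mem_last.
    by rewrite E mem_last.
  rewrite -[W t n.+1]/(W t n ++ _) -[W t' n.+1]/(W t' n ++ _) -!cat_cons !mem_cat.
  have [_ _ _ gC gdis] := gP n _ (Wlast t n bt).
  have [_ _ _ gC' _] := gP n _ (Wlast t' n bt').
  case/orP=> z1 /orP[] z2; first exact: (IH z).
  - by have [Cz _] := gC' z z2; apply: (WnC t n z bt).
  - by have [Cz _] := gC z z1; apply: (WnC t' n z bt').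
  - by apply: lastne; apply: gdis z1 z2; apply: Wlast.
exists C, r; split.
- by move=> n; have [[]] := tC n.
(* Consecutive boundaries are disjoint, so each level costs a step: a walk from outside [C 0] into
   [C n] has more than [n] steps. Hence the sets [C n] eventually miss any finite set. *)
- have far n x p : ~ C 0 x -> path e x p -> C n (last x p) -> n < size p.
    elim: n p => [|n IH] p nCx pth Cl; first by case: p pth Cl.
    have [|//|p1 [z [p2 [Ep nCp1 [nnCz _]]]]] := walk_exit (A := ~` C n.+1) pth.
      by move=> /(Cmono 0 n.+1 isT).
    have {nnCz} Cz : C n.+1 z by exact: contrapT.
    move: pth; rewrite Ep cat_path => /= /and3P[pth1 uz _].
    have nCu : ~ C n.+1 (last x p1) by apply: nCp1; rewrite mem_last.
    rewrite size_cat /= addnS ltnS; apply: leq_trans (leq_addr _ _).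
    apply: IH => //; apply: contrapT => nCnu.
    have bu : bd e (C n.+1) (last x p1) by split=> //; exists z; rewrite // e_sym.
    apply: (Cdis n (last x p1)); first by right.
    by split=> //; exists z; [exact: CS | rewrite e_sym].
  have nCt0 : ~ C 0 t0 by case: bt0.
  have away v : exists n, ~ C n v.
    have [//|//|p [pth lp _]] := e_conn (x := t0) (y := v).
    by exists (size p) => Cv; have := far (size p) t0 p nCt0 pth; rewrite lp ltnn => /(_ Cv).
  move=> A /finite_seqP[s ->]; elim: s => [|v s [n nP]]; first by exists 0.
  have [m mP] := away v; exists (maxn n m) => z /=; rewrite inE => /orP[/eqP->|zs] Cz.
    by apply: mP; apply: Cmono Cz; exact: leq_maxr.
  by apply: (nP z) => //; apply: Cmono Cz; exact: leq_maxl.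
- move=> t bt; split.
    move=> i j; rewrite (rE t i (maxn i j)) ?(rE t j (maxn i j)) //; first last.
    + exact: leq_trans (leq_maxl _ _) (Wsize _ _ bt).
    + exact: leq_trans (leq_maxr _ _) (Wsize _ _ bt).
    move/eqP; rewrite nth_uniq ?Wuniq //= ?ltnS; first by move/eqP.
    + exact: leq_trans (leq_maxl _ _) (Wsize _ _ bt).
    + exact: leq_trans (leq_maxr _ _) (Wsize _ _ bt).
  move=> n; have sz := Wsize t n.+1 bt.
  rewrite (rE t n n.+1) ?(rE t n.+1 n.+1) //; last exact: ltnW.
  by have /(pathP t)/(_ n sz) := Wpath t n.+1 bt.
- move=> t n bt; exists (size (W t n)).+1 => k nk.
  have nk' : n <= k by apply: leq_trans (Wsize t n bt) (ltnW nk).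
  have [R ER RC] := Wcat t n k bt nk'.
  rewrite /r ER -cat_cons nth_cat /= ltnNge nk /=; apply/RC/mem_nth.
  by have := Wsize t k bt; rewrite ER size_cat /=; move: nk => /=; lia.
- move=> t t' i j bt bt'; have [//|/eqP tt'] := eqVneq t t' => Er.
  case: (Wdis t t' (maxn i j) (r t i) bt bt' tt').
    rewrite (rE t i (maxn i j)) //; last exact: leq_trans (leq_maxl _ _) (Wsize _ _ bt).
    by rewrite mem_nth //= ltnS; exact: leq_trans (leq_maxl _ _) (Wsize _ _ bt).
  rewrite Er (rE t' j (maxn i j)) //; last exact: leq_trans (leq_maxr _ _) (Wsize _ _ bt').
  by rewrite mem_nth //= ltnS; exact: leq_trans (leq_maxr _ _) (Wsize _ _ bt').
Qed.

End LargeSets.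

Lemma finite_part K : connected_off e set0 ->
  (forall w : set (nat -> V), is_end e w -> exists2 k, end_size w k & k <= 2) ->
  finite_set K -> finite_set (part e K).
Proof.
move=> e_conn ends_le2 fK; apply: contrapT => iP.
have lT : large (part e K) setT.
  split; last by rewrite setTI.
    by move=> x y _ _; have [p [? ? _]] := e_conn x y id id; exists p; split.
  rewrite (_ : bd e setT = set0) //; by apply/seteqP; split=> // z [/(_ I)].
have [C0 [_ tC0 C0K]] := tight_avoid lT fK.
have [lC0 _] := tC0; have [cC0 fC0 _] := lC0.
have [n [s [us sz Es]]] := finite_bdsize fC0.
(* With at most two boundary vertices [C0] would be a [K]-cone, but it contains a vertex of
   [part K]. *)
have n3 : 3 <= n.
  rewrite ltnNge; apply/negP => n2; have [c Cc] := large_point lC0; apply.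
  exists C0; split=> //; split=> //; [by exists c | by move=> z Cz; apply: C0K; left |].
  move=> s' us' s's; apply: leq_trans n2; rewrite -sz.
  by apply: uniq_leq_size => // z /s's; rewrite Es.
case: s us sz Es => [|t0 s'] us sz Es; first by move: n3; rewrite -sz.
set s := t0 :: s' in us sz Es; pose t i := nth t0 s i.
have bt i : i < 3 -> bd e C0 (t i).
  by move=> i3; rewrite Es /=; apply: mem_nth; rewrite sz; apply: leq_trans n3.
have [C [r [cC Cfar r_ray r_tail r_dis]]] := tight_rays e_conn tC0 (bt 0 isT).
(* Both rays have tails in the connected set [C m], which avoids the finite set [A]. *)
have equiv i : i < 3 -> ray_equiv e (r (t 0)) (r (t i)).
  move=> i3 A fA; have [m Am] := Cfar A fA.
  have [m1 m1P] := r_tail _ m (bt 0 isT); have [m2 m2P] := r_tail _ m (bt i i3).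
  exists m1, m2 => j1 j2 h1 h2; have [p [? ? pC]] := cC m _ _ (m1P j1 h1) (m2P j2 h2).
  by exists p; split=> // z /pC Cz Az; apply: (Am z).
pose w := [set q | ray e q /\ ray_equiv e (r (t 0)) q].
have [|k [_ kmax] k2] := ends_le2 w.
  by exists (r (t 0)) => //; apply: r_ray; apply: bt.
suff /kmax k3 : has_disjoint_rays w 3 by move: (leq_trans k3 k2).
exists (fun i => r (t i)); split.
  by move=> i; split; [apply: r_ray; apply: bt | apply: equiv].
move=> i j _ _ [z [[a _ <-] [b _ /esym Eab]]].
have /eqP := r_dis _ _ _ _ (bt i (ltn_ord i)) (bt j (ltn_ord j)) Eab.
by rewrite nth_uniq // ?sz ?(leq_trans _ n3) // => /eqP/val_inj.
Qed.

End Rays.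

(** * Cones up to automorphism *)

Lemma finite_subsets (V : eqType) (W : set V) :
  finite_set W -> finite_set [set B : set V | B `<=` W].
Proof.
move=> /finite_seqP[s ->]; elim: s => [|z s IH].
  apply: (@sub_finite_set _ _ [set set0]); last exact: finite_set1.
  by move=> B BW; apply/seteqP; split=> // v /BW.
apply: (@sub_finite_set _ _ ([set B | B `<=` [set` s]] `|`
    [set z |` B | B in [set B | B `<=` [set` s]]])).
  move=> B BW; pose B' := B `&` [set` s].
  have B's : B' `<=` [set` s] by move=> v [].
  have [Bz|nBz] := pselect (B z); [right | left].
    exists B' => //; apply/seteqP; split=> v; first by case=> [->|[]].
    by move=> Bv; have := BW v Bv; rewrite /= inE => /orP[/eqP->|vs]; [left|right].
  by move=> v Bv; have := BW v Bv; rewrite /= inE => /orP[/eqP vz|//]; rewrite vz in Bv.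
by rewrite finite_setU; split=> //; apply: finite_image.
Qed.

Section Cones.

Variables (V : choiceType) (e : rel V).
Hypothesis e_sym : symmetric e.
Hypothesis e_2conn : two_connected e.
Hypothesis e_lf : locally_finite e.
Implicit Types (A C D K : set V) (p s : seq V).

(** The last clause asks for a vertex beyond the boundary; in a 2-connected graph it forces exactly
    two boundary vertices. *)
Definition cone D : Prop :=
  [/\ D !=set0, conn e D, atmost 2 (bd e D) & exists v, ~ D v /\ ~ bd e D v].

(* The neighbours of the boundary are included so that the maximal [gate D]-cones
   inside [D] are smaller than [D], and a walk entering [D] starts at a vertex of
   [part (gate D)]. *)
Definition gate D : set V := bd e D `|` (D `&` nbrs e (bd e D)).

Definition saturated K A : Prop := forall v w, piece e K v w -> A v -> A w.

Lemma boundary_point C x y : C x -> ~ C y -> bd e C !=set0.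
Proof.
move=> Cx nCy; have [_ cV _] := e_2conn.
have [//|//|p [pth lp _]] := cV x y.
have [|p1 [z [p2 [_ _ bz]]]] := walk_exit pth Cx _; first by rewrite lp.
by exists z.
Qed.

Lemma boundary_second a C x y : C x -> ~ C y -> x <> a -> y <> a ->
  exists2 b, bd e C b & b <> a.
Proof.
move=> Cx nCy xa ya; have [_ _ /(_ a)/contrapT ca] := e_2conn.
have [//|//|p [pth lp pa]] := ca x y.
have [|p1 [z [p2 [Ep _ bz]]]] := walk_exit pth Cx _; first by rewrite lp.
by exists z => // za; apply: (pa z) => //; rewrite Ep inE mem_cat mem_head !orbT.
Qed.

Lemma cone_bd2 D a : cone D -> bd e D a -> exists b, b <> a /\ bd e D = [set a; b].
Proof.
move=> [[x Dx] _ bD [v [nDv nbv]]] ba.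
have [||b bb nba] := boundary_second (a := a) Dx nDv.
- by move=> xa; case: ba; rewrite -xa.
- by move=> va; rewrite va in nbv.
exists b; split=> //; apply/seteqP; split=> z; last by case=> ->.
move=> bz; apply: contrapT => nz; have := bD [:: a; b; z].
rewrite /= !inE andbT => /(_ _ _)/negP; apply; rewrite -?leqNgt //.
  rewrite !negb_or -!andbA; apply/and3P; split; apply/eqP.
  - by move=> ab; rewrite ab in nba.
  - by move=> az; apply: nz; left.
  - by move=> bz'; apply: nz; right.
by move=> u; rewrite !inE => /or3P[] /eqP->.
Qed.

Lemma cone_bd_eq D x y y' : cone D -> bd e D x -> bd e D y -> bd e D y' ->
  y <> x -> y' <> x -> y = y'.
Proof.
move=> cD bx; have [b [_ ->]] := cone_bd2 cD bx.
by move=> [->//|->] [->//|->].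
Qed.

(* Since [a] is not a cutvertex, the second boundary vertex of a cone at [a] lies
   on a fixed path avoiding [a] between two neighbours of [a]. *)
Lemma cone_bd_bounded a : exists2 F : set V, finite_set F &
  forall D b, cone D -> bd e D a -> bd e D b -> b <> a -> F b.
Proof.
have [_ _ /(_ a)/contrapT ca] := e_2conn.
have /boolp.choice[P PP] : forall cd : V * V, exists p, cd.1 <> a -> cd.2 <> a ->
    [/\ path e cd.1 p, last cd.1 p = cd.2 & forall z, z \in cd.1 :: p -> z <> a].
  move=> [c d] /=; have [c1|] := pselect (c <> a); last by exists [::].
  have [d1|] := pselect (d <> a); last by exists [::].
  by have [//|//|p pP] := ca c d; exists p.
exists (\bigcup_(c in [set y | e a y]) \bigcup_(d in [set y | e a y]) [set` P (c, d)]).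
  apply: bigcup_finite; first exact: e_lf.
  move=> c _; apply: bigcup_finite; first exact: e_lf.
  by move=> d _; apply/finite_seqP; exists (P (c, d)).
move=> D b cD ba bb nba; have [[x Dx] _ _ [v [nDv nbv]]] := cD.
have [b' [nb' E]] := cone_bd2 cD ba.
have Ebb : b' = b by move: bb; rewrite E => -[|].
rewrite Ebb in E.
have [nDa [c Dc ca']] := ba.
(* The far side of [D]. As [b] is not a cutvertex, [a] has a neighbour [d] there, besides its
   neighbour [c] in [D]; the chosen path from [c] to [d] avoids [a], so it leaves [D] through
   [b]. *)
pose D' := ~` (D `|` bd e D).
have bD' : bd e D' `<=` bd e D.
  move=> z [nD'z [y D'y yz]]; apply: contrapT => nbz; apply: nD'z => -[Dz|//].
  by apply: (D'y); right; split; [move=> Dy; apply: D'y; left | exists z; rewrite // e_sym].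
have [||||z bz nzb] := @boundary_second b D' v c.
- by case.
- by apply; left.
- by move=> vb; apply: nbv; rewrite vb.
- by move=> cb; have [] := bb; rewrite -cb.
have za : z = a by have := bD' z bz; rewrite E => -[|].
move: bz; rewrite za => -[_ [d D'd da]].
have ac : e a c by rewrite e_sym.
have ad : e a d by rewrite e_sym.
exists c => //; exists d => //=.
have nca : c <> a by move=> h; apply: nDa; rewrite -h.
have nda : d <> a by move=> h; apply: D'd; right; rewrite h.
have [pth lp Pa] := PP (c, d) nca nda.
have [|p1 [u [p2 [Ep _ bu]]]] := walk_exit pth Dc _.
  by rewrite lp => Dd; apply: D'd; left.
have <- : u = b.
  have ua : u <> a by apply: Pa; rewrite Ep inE mem_cat mem_head !orbT.
  by move: bu; rewrite E => -[|].
by rewrite Ep mem_cat mem_head orbT.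
Qed.

(** [C] misses [K], and at most two of the three vertices are in its boundary, so another one lies
    beyond. *)
Lemma kcone_cone K C : (exists s, [/\ uniq s, 2 < size s & forall z, z \in s -> K z]) ->
  kcone e K C -> cone C.
Proof.
move=> [s [us s2 sK]] [C0 cC CK bC]; split=> //.
apply: contrapT => no; move: s2; rewrite ltnNge => /negP; apply; apply: bC => // z zs.
apply: contrapT => nb; apply: no; exists z; split=> // Cz; exact: CK (sK z zs).
Qed.

Lemma sub_part K : K `<=` part e K.
Proof. by move=> v Kv [C [[_ _ CK _] /CK]]. Qed.

(** Every piece has a boundary vertex, which is in [part K], so the piece contains a neighbour of
    [part K]. Hence a saturated set is determined by its trace on the finite set [W]. *)
Lemma finite_saturated K : K !=set0 -> finite_set (part e K) ->
  finite_set [set A | saturated K A].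
Proof.
move=> [k Kk] fP; pose W := part e K `|` nbrs e (part e K).
have fW : finite_set W by rewrite finite_setU; split=> //; exact: finite_nbrs.
pose h (B : set V) := [set v | (part e K v /\ B v) \/ exists2 w, piece e K v w & B w].
apply: (@sub_finite_set _ _ [set h B | B in [set B | B `<=` W]]); last first.
  exact/finite_image/finite_subsets.
move=> A sA; exists (A `&` W); first by move=> v [].
apply/seteqP; split=> v.
  move=> [[_ []//]|[w vw [Aw _]]].
  by apply: sA Aw; case: vw => C [? ? ?]; exists C.
move=> Av; have [Pv|nPv] := pselect (part e K v).
  by left; split=> //; split=> //; left.
right; have kv := piece_kcone e_sym nPv.
have [b bb] : bd e (piece e K v) !=set0.
  by apply: (@boundary_point _ v k); [exact: piece_self | case: kv => _ _ + _ => /[apply]].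
have Pb := bd_piece_part e_sym nPv bb; have [_ [w vw wb]] := bb.
exists w => //; split; first exact: sA Av.
by right; exists b; rewrite // e_sym.
Qed.

End Cones.

(** * Transport along an automorphism *)

Section Automorphisms.

Variables (V : choiceType) (e : rel V) (g h : V -> V).
Hypotheses (gK : cancel g h) (hK : cancel h g).
Hypothesis ge : forall x y, e (g x) (g y) = e x y.
Implicit Types (A C D : set V).

Lemma inverse_edge x y : e (h x) (h y) = e x y.
Proof. by rewrite -ge !hK. Qed.

Lemma bd_preimage D : bd e (g @^-1` D) = g @^-1` bd e D.
Proof.
apply/seteqP; split=> z [nDz [y Dy yz]]; split=> //.
  by exists (g y); rewrite // ge.
by exists (h y); rewrite /= ?hK // -ge hK.
Qed.

Lemma conn_preimage D : conn e D -> conn e (g @^-1` D).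
Proof.
move=> cD x y Dx Dy; have [p [pth lp Dp]] := cD _ _ Dx Dy.
exists (map h p); split.
- rewrite -(gK x) path_map (eq_path (e' := e)) // => u v; exact: inverse_edge.
- by rewrite -(gK x) last_map lp gK.
- rewrite -(gK x) -map_cons => _ /mapP[u up ->] /=; rewrite hK; exact: Dp.
Qed.

Lemma atmost_preimage n A : atmost n A -> atmost n (g @^-1` A).
Proof.
move=> An s us sA; rewrite -(size_map g); apply: An.
  by rewrite (map_inj_uniq (can_inj gK)).
by move=> _ /mapP[u us' ->]; exact: sA.
Qed.

Lemma cone_preimage D : cone e D -> cone e (g @^-1` D).
Proof.
move=> [[x Dx] cD bD [v [nDv nbv]]]; split.
- by exists (h x); rewrite /= hK.
- exact: conn_preimage.
- by rewrite bd_preimage; exact: atmost_preimage.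
- by exists (h v); rewrite bd_preimage /= hK.
Qed.

End Automorphisms.

(** * Decomposition of self-avoiding walks *)

Section WalkLanguages.

Variables (V : choiceType) (e : rel V) (Sigma : finType) (l : V -> V -> Sigma).
Hypothesis l_det : deterministic e l.
Implicit Types (A C D G : set V).

Definition walks x A G : set (seq V) := [set p |
  [/\ path e x p, uniq p, forall z, z \in p -> A z & G (last x p)]].

Definition walk_language x A G : set (seq Sigma) :=
  [set pairmap l x p | p in walks x A G].

Lemma pairmap_walk_inj x p q : path e x p -> path e x q ->
  pairmap l x p = pairmap l x q -> p = q.
Proof.
elim: p q x => [|y p IH] [|z q] x //= /andP[xy py] /andP[xz qz] [El Epq].
have Eyz := l_det.1 _ _ _ xy xz El; rewrite -Eyz in Epq qz *.
by rewrite (IH q y).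
Qed.

Lemma walk_language_sub (g h : V -> V) x A G :
  cancel g h -> cancel h g -> label_aut e l g ->
  walk_language x (g @^-1` A) (g @^-1` G) `<=` walk_language (g x) A G.
Proof.
move=> gK hK [_ ge gl] _ [p [pth up Ap Gp] <-]; exists (map g p).
  split.
  - by rewrite path_map (eq_path (e' := e)) // => u v; rewrite /= ge.
  - by rewrite (map_inj_uniq (can_inj gK)).
  - by move=> _ /mapP[u /Ap ? ->].
  - by rewrite last_map.
by elim: p x pth {up Ap Gp} => //= y p IH x /andP[xy /IH ->]; rewrite gl.
Qed.

Lemma walk_language_preimage (g h : V -> V) x A G :
  cancel g h -> cancel h g -> label_aut e l g -> label_aut e l h ->
  walk_language (g x) A G = walk_language x (g @^-1` A) (g @^-1` G).
Proof.
move=> gK hK ag ah; apply/seteqP; split; last exact: walk_language_sub.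
have hgE B : h @^-1` (g @^-1` B) = B by apply/seteqP; split=> v /=; rewrite hK.
have := walk_language_sub (x := g x) (A := g @^-1` A) (G := g @^-1` G) hK gK ah.
by rewrite !hgE gK.
Qed.

End WalkLanguages.

(** The cut is at the first entry violating [P]. *)
Lemma rcons_cat_inj (T : eqType) (P : T -> Prop) q q' y y' (r r' : seq T) :
  (forall u, u \in q -> P u) -> (forall u, u \in q' -> P u) -> ~ P y -> ~ P y' ->
  rcons q y ++ r = rcons q' y' ++ r' -> [/\ q = q', y = y' & r = r'].
Proof.
elim: q q' => [|u q IH] [|u' q'] //= qP q'P Py Py'.
- by case=> -> ->.
- by case=> E _; case: Py; rewrite E; apply: q'P; rewrite mem_head.
- by case=> E _; case: Py'; rewrite -E; apply: qP; rewrite mem_head.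
case=> -> /IH[] // => [v vq|v vq|-> -> ->//].
  by apply: qP; rewrite inE vq orbT.
by apply: q'P; rewrite inE vq orbT.
Qed.

Lemma factors_one (S : Type) (M : set (seq S)) ws :
  factors id ([:: inl M] : seq (_ + S)) ws -> exists2 w, ws = [:: w] & M w.
Proof. by case: ws => [|w [|? ?]] //= [] // Mw _; exists w. Qed.

Lemma factors_two (S : Type) (M M' : set (seq S)) ws :
  factors id ([:: inl M; inl M'] : seq (_ + S)) ws ->
  exists w w', [/\ ws = [:: w; w'], M w & M' w'].
Proof.
by case: ws => [|w [|w' [|? ?]]] //= [] // Mw [] // Mw' _; exists w, w'.
Qed.

(** * States and rules of the walk grammar *)

Section States.

Variables (V : choiceType) (e : rel V) (Sigma : finType) (l : V -> V -> Sigma).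
Hypothesis e_sym : symmetric e.
Hypothesis e_2conn : two_connected e.
Hypothesis e_lf : locally_finite e.
Hypothesis l_det : deterministic e l.
Variable Gamma : set (V -> V).
Hypothesis Gamma_aut : label_aut_subgroup e l Gamma.
Hypothesis Gamma_qt : quasi_transitive Gamma.
Hypothesis part_fin : forall K, finite_set K -> finite_set (part e K).
Implicit Types (A C D G K : set V).

Lemma finite_orbit_representatives :
  exists2 X : set V, finite_set X & forall x, exists g y, [/\ Gamma g, X y & g y = x].
Proof.
have [_ Gid _ Ginv] := Gamma_aut.
have /boolp.choice[rep repP] : forall O : set V, exists x : V,
    range (orbit_of Gamma) O -> orbit_of Gamma x = O.
  move=> O; have [[x _ <-]|nO] := pselect (range (orbit_of Gamma) O); first by exists x.
  by have [[[|x s] //= _] _ _] := e_2conn; exists x.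
exists (rep @` range (orbit_of Gamma)); first exact: finite_image.
move=> x; have : orbit_of Gamma x x by exists id.
rewrite -(repP (orbit_of Gamma x)); last by exists x.
move=> [g Gg gx]; exists g, (rep (orbit_of Gamma x)); split=> //.
by exists (orbit_of Gamma x) => //; exists x.
Qed.

(** Move one boundary vertex of the cone to some [a] in the finite set [X]. The other one, [b], is
    then in the finite set [F a], and the cone is the component, off [a] and [b], of a neighbour [c]
    of [a]. *)
Lemma finite_cone_representatives :
  exists DD : set (set V), [/\ finite_set DD, forall D, DD D -> cone e D
    & forall D, cone e D -> exists2 g, Gamma g & DD (g @^-1` D)].
Proof.
have [X fX XP] := finite_orbit_representatives.
have /boolp.choice[F FP] : forall a, exists F : set V, finite_set F /\
    forall D b, cone e D -> bd e D a -> bd e D b -> b <> a -> F b.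
  by move=> a; have [F ? ?] := cone_bd_bounded e_sym e_2conn e_lf a; exists F.
pose comp a b c := [set y | reach e (~` [set a; b]) c y].
pose DD0 := \bigcup_(a in X) \bigcup_(b in F a) \bigcup_(c in [set y | e a y])
  [set comp a b c].
exists (DD0 `&` [set D | cone e D]); split; last 1 first.
- move=> D cD; have [[x Dx] _ _ [v [nDv _]]] := cD.
  have [a0 ba0] := boundary_point e_2conn Dx nDv.
  have [g [a [Gg Xa ga]]] := XP a0; exists g => //.
  have [Gsub _ _ Ginv] := Gamma_aut; have [h Gh [gK hK]] := Ginv g Gg.
  have [_ ge _] := Gsub g Gg.
  have cgD := cone_preimage gK hK ge cD; split=> //.
  have ba : bd e (g @^-1` D) a by rewrite (bd_preimage hK ge) /= ga.
  have [b [nba E]] := cone_bd2 e_2conn cgD ba.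
  have bb : bd e (g @^-1` D) b by rewrite E; right.
  exists a => //; exists b; first exact: (FP a).2 bb nba.
  have [_ [c Dc ca]] := ba; exists c; first by rewrite /= e_sym.
  have [_ con _ _] := cgD.
  by rewrite /comp -E; exact: conn_componentE.
- apply: finite_setIl; apply: bigcup_finite => // a _.
  apply: bigcup_finite; first exact: (FP a).1.
  by move=> b _; apply: bigcup_finite; [exact: e_lf | move=> c _; exact: finite_set1].
- by move=> D [].
Qed.

(* [(K, (x, A, G))]: walks from [x] inside [A] with last vertex in [G]; the sets [A]
   and [G] are unions of pieces of [K] and of vertices of [part K]. *)
Let St : Type := (set V * (V * set V * set V))%type.

Let Lng (s : St) : set (seq Sigma) :=
  walk_language e l s.2.1.1 s.2.1.2 s.2.2.

(** The current vertex is already used, so it is outside [A]; it lies in [part K], so a step from it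
    into a piece starts at a boundary vertex of that piece. *)
Let ok (s : St) : Prop :=
  [/\ part e s.1 s.2.1.1, ~ s.2.1.2 s.2.1.1, saturated e s.1 s.2.1.2
    & saturated e s.1 s.2.2].

Lemma finite_ok_languages K : finite_set K -> K !=set0 ->
  finite_set (Lng @` [set s | s.1 = K /\ ok s]).
Proof.
move=> fK K0; apply: finite_image.
have fP := part_fin fK.
have fS := finite_saturated e_sym e_2conn e_lf K0 fP.
apply: (@sub_finite_set _ _ ([set K] `*` (part e K `*` [set A | saturated e K A]
   `*` [set A | saturated e K A]))).
  by move=> [K' [[x A] G]] /= [-> [/= ? _ ? ?]].
by apply: finite_setX; [exact: finite_set1 | apply: finite_setX => //; apply: finite_setX].
Qed.

(** The states reached on entering a cone, where [Y] holds the boundary vertices still allowed. Both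
    [z] and [bd D] belong to the gate, so a piece meeting [D] stays in [D] and misses [z]. *)
Lemma ok_entry D z Y : cone e D -> D z -> nbrs e (bd e D) z -> Y `<=` bd e D ->
  ok (gate e D, (z, (D `\ z) `|` Y, D)) /\
  forall y, bd e D y -> ok (gate e D, (z, (D `\ z) `|` Y, [set y])).
Proof.
move=> [_ cD _ _] Dz Nz YD.
have gz : gate e D z by right.
have inD v w : piece e (gate e D) v w -> D v -> D w /\ w <> z.
  move=> [C [[_ cC CK _] Cv Cw]] Dv; split.
    by apply: (conn_subset cC Cv Dv) Cw => u /CK h bu; apply: h; left.
  by move=> wz; apply: (CK w) => //; rewrite wz.
have ninb v w : piece e (gate e D) v w -> ~ bd e D v.
  by move=> [C [[_ _ CK _] Cv _]] bv; apply: (CK v) => //; left.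
have s1 : saturated e (gate e D) ((D `\ z) `|` Y).
  move=> v w vw [[Dv _]|/YD/(ninb _ _ vw)//].
  by left; have [] := inD v w vw Dv.
have nz : ~ ((D `\ z) `|` Y) z by move=> [[_ /(_ erefl)]|/YD[]].
split=> [|y by_]; split=> //=; try exact: sub_part.
  by move=> v w vw /(inD _ _ vw)[].
by move=> v w vw vy; case: (ninb _ _ vw); rewrite vy.
Qed.

(** Closure of the state space: pieces of any [K] in [KK] are cones, and the gates of their
    representatives in [DD] are in [KK] again. *)
Variable DD : set (set V).
Hypothesis DD_cone : forall D, DD D -> cone e D.
Hypothesis DD_rep : forall D, cone e D -> exists2 g, Gamma g & DD (g @^-1` D).
Variable KK : set (set V).
Hypothesis KK_gate : forall D, DD D -> KK (gate e D).
Hypothesis KK_cone : forall K C, KK K -> kcone e K C -> cone e C.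

Let valid (s : St) : Prop := KK s.1 /\ ok s.

(** An element of [Gamma] moves [D] to its representative and preserves labels, so this is the
    language of a state over the gate of the representative. *)
Lemma entry_language D z Y G : cone e D -> D z -> nbrs e (bd e D) z ->
  Y `<=` bd e D -> G = D \/ (exists2 y, bd e D y & G = [set y]) ->
  (Lng @` valid) (walk_language e l z ((D `\ z) `|` Y) G).
Proof.
move=> cD Dz Nz YD GE; have [g Gg DDg] := DD_rep cD.
have [Gsub _ _ Ginv] := Gamma_aut; have [h Gh [gK hK]] := Ginv g Gg.
have ag := Gsub g Gg; have ah := Gsub h Gh; have [_ ge _] := ag.
have cD' := DD_cone DDg.
have bdE := bd_preimage hK ge D.
have Nz' : nbrs e (bd e (g @^-1` D)) (h z).
  by have [y by_ yz] := Nz; exists (h y); rewrite ?bdE /= ?hK // -ge !hK.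
have YD' : g @^-1` Y `<=` bd e (g @^-1` D) by rewrite bdE => v /YD.
have Dz' : (g @^-1` D) (h z) by rewrite /= hK.
have [ok1 ok2] := ok_entry cD' Dz' Nz' YD'.
rewrite -{1}(hK z) (walk_language_preimage _ _ _ gK hK ag ah).
have -> : g @^-1` ((D `\ z) `|` Y) = ((g @^-1` D) `\ h z) `|` (g @^-1` Y).
  apply/seteqP; split=> v [[Dv vz]|Yv]; [left|by right|left|by right]; split=> //.
    by move=> /= vE; apply: vz; rewrite /= vE hK.
  by move=> /= vE; apply: vz; rewrite /= -vE gK.
case: GE => [->|[y by_ ->]].
  exists (gate e (g @^-1` D), (h z, ((g @^-1` D) `\ h z) `|` (g @^-1` Y), g @^-1` D)) => //.
  by split; [exact: KK_gate | exact: ok1].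
have -> : g @^-1` [set y] = [set h y].
  by apply/seteqP; split=> v /= => [<-|->]; rewrite ?gK ?hK.
exists (gate e (g @^-1` D), (h z, ((g @^-1` D) `\ h z) `|` (g @^-1` Y), [set h y])) => //.
by split; [exact: KK_gate | apply: ok2; rewrite ?bdE /= ?hK].
Qed.

(* The walk steps to a vertex [z] of [part K]; or it enters the piece of [z] and ends
   there, possibly through its other boundary vertex; or it traverses that piece and
   leaves it for good at [y]. *)
Let rule (s : St) (a : Sigma) (Ms : seq (set (seq Sigma))) : Prop :=
  let: (K, (x, A, G)) := s in
  exists z, [/\ e x z, l x z = a, A z &
  [\/ part e K z /\ Ms = [:: walk_language e l z (A `\ z) G],
      [/\ ~ part e K z, G z & Ms = [:: walk_language e l z
         ((piece e K z `\ z) `|` (A `&` bd e (piece e K z))) (piece e K z)]]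
    | ~ part e K z /\ exists y, [/\ bd e (piece e K z) y, A y
        & Ms = [:: walk_language e l z ((piece e K z `\ z) `|` [set y]) [set y];
                   walk_language e l y (A `\ y `\` piece e K z) G]]]].

Lemma enter_piece K x A G z : valid (K, (x, A, G)) -> ~ part e K z -> e x z -> A z ->
  [/\ cone e (piece e K z), bd e (piece e K z) x, piece e K z z,
      nbrs e (bd e (piece e K z)) z & piece e K z `<=` A].
Proof.
move=> [KKK [/= Px nAx sA sG]] nPz xz Az.
have Dz := piece_self nPz.
have bx : bd e (piece e K z) x.
  by split; [move/piece_sub_part | exists z; rewrite // e_sym].
split=> //; first exact: KK_cone (piece_kcone e_sym nPz).
  by exists x.
by move=> w zw; apply: sA Az.
Qed.

Lemma rule_valid s a Ms : valid s -> rule s a Ms ->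
  size Ms <= 2 /\ forall M, M \in Ms -> (Lng @` valid) M.
Proof.
case: s => K [[x A] G] vs [z [xz la Az cases]].
have [KKK [/= Px nAx sA sG]] := vs.
case: cases => [[Pz ->]|[nPz Gz ->]|[nPz [y [by_ Ay ->]]]]; split=> // M.
- rewrite mem_seq1 => /eqP->; exists (K, (z, A `\ z, G)) => //; split=> //; split=> //=.
    by move=> [_ /(_ erefl)].
  move=> v w vw [Av vz]; split; first exact: sA vw Av.
  by move=> /= wz; apply: (piece_sub_part vw); rewrite wz.
- have [cD bx Dz Nz DA] := enter_piece vs nPz xz Az.
  by rewrite mem_seq1 => /eqP->; apply: entry_language => //; left.
have [cD bx Dz Nz DA] := enter_piece vs nPz xz Az.
rewrite in_cons mem_seq1 => /orP[]/eqP->.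
  by apply: entry_language => //; [move=> v -> | right; exists y].
have Py : part e K y by apply: bd_piece_part by_.
exists (K, (y, A `\ y `\` piece e K z, G)) => //; split=> //; split=> //=.
  by move=> [[_ /(_ erefl)]].
move=> v w vw [[Av vy] nDv]; split; first split.
- exact: sA vw Av.
- by move=> /= wy; apply: (piece_sub_part vw); rewrite wy.
- move=> zw; apply: nDv; rewrite -(piece_eq e_sym zw).
  by case: vw => C [? ? ?]; exists C.
Qed.

Lemma rule_complete s a w : valid s -> Lng s (a :: w) ->
  exists Ms ws, [/\ rule s a Ms, factors id (map inl Ms) ws & flatten ws = w].
Proof.
case: s => K [[x A] G] vs [[|z p] //= [/= /andP[xz pth] /andP[zp up] Ap Gp] [la Ew]].
have [KKK [/= Px nAx sA sG]] := vs.
have Az : A z by apply: Ap; rewrite mem_head.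
have {}Ap u : u \in p -> A u by move=> h; apply: Ap; rewrite inE h orbT.
have pz u : u \in p -> u <> z by move=> h uz; rewrite -uz h in zp.
have [Pz|nPz] := pselect (part e K z).
  exists [:: walk_language e l z (A `\ z) G], [:: w]; split=> /=; last by rewrite cats0.
    by exists z; split=> //; apply: Or31.
  by split=> //; exists p => //; split=> // u up'; split; [exact: Ap | exact: pz].
have [cD bx Dz Nz DA] := enter_piece vs nPz xz Az; set D := piece e K z in cD bx Dz Nz DA *.
have nx u : A u -> u <> x by move=> Au ux; apply: nAx; rewrite -ux.
have [Dl|nDl] := pselect (D (last z p)).
  exists [:: walk_language e l z ((D `\ z) `|` (A `&` bd e D)) D], [:: w].
  split=> /=; last by rewrite cats0.
    exists z; split=> //; apply: Or32; split=> //.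
    by apply: sG Gp; rewrite -/D; case: (Dl) => C [? ? ?]; exists C.
  split=> //; exists p => //; split=> // u up'.
  have [Du|nDu] := pselect (D u); first by left; split=> //; exact: pz.
  right; split; first exact: Ap.
  (* A walk visiting [u] outside [D] exits at [y], no later than [u], and re-enters from
     [last u r1]. Both are boundary vertices other than [x], hence equal, and self-avoidance makes
     [u] that vertex. *)
  case/splitPr: up' pth up Ap Dl => p1 p2; rewrite cat_path last_cat /=.
  move=> /and3P[pth1 pu pth2] up Ap Dl.
  have pth1' : path e z (rcons p1 u) by rewrite rcons_path pth1.
  have [|q1 [y [q2 [Ep1 _ by_]]]] := walk_exit pth1' Dz _; first by rewrite last_rcons.
  have [//|nnDl|r1 [v [r2 [Ep2 r1D [nnDv _]]]]] := walk_exit (A := ~` D) pth2; first by [].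
  have Dv : D v by exact: contrapT.
  move: pth2; rewrite Ep2 cat_path /= => /and3P[_ uv _].
  have by' : bd e D (last u r1).
    by split; [apply: r1D; rewrite mem_last | exists v; rewrite // e_sym].
  have yin : y \in rcons p1 u by rewrite Ep1 mem_cat mem_head orbT.
  have y'in : last u r1 \in u :: p2 by rewrite Ep2 -cat_cons mem_cat mem_last.
  have E : y = last u r1.
    apply: (cone_bd_eq e_2conn cD bx by_ by').
      by apply: nx; apply: Ap; rewrite -cat_rcons mem_cat yin.
    by apply: nx; apply: Ap; rewrite mem_cat y'in orbT.
  move: y'in; rewrite inE => /orP[/eqP <-|y'in]; first by rewrite -E.
  move: up; rewrite -cat_rcons cat_uniq => /and3P[_ /hasPn/(_ _ y'in) + _].
  by rewrite /= -E yin.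
(* The traversing case: the walk is cut at its first vertex [y] outside [D]. *)
have [p1 [y [p2 [Ep p1D by_]]]] := walk_exit pth Dz nDl.
have Ay : A y by apply: Ap; rewrite Ep mem_cat mem_head orbT.
exists [:: walk_language e l z ((D `\ z) `|` [set y]) [set y];
           walk_language e l y (A `\ y `\` D) G],
  [:: pairmap l z (rcons p1 y); pairmap l y p2].
move: pth up Ap Gp nDl Ew; rewrite Ep -cat_rcons cat_path last_cat last_rcons cat_uniq.
move=> /andP[pth1 pth2] /and3P[up1 /hasPn dis up2] Ap Gp nDl Ew; split=> /=.
- by exists z; split=> //; apply: Or33; split=> //; exists y.
- split.
    exists (rcons p1 y) => //; split=> //; last by rewrite last_rcons.
    move=> u; rewrite mem_rcons inE => /orP[/eqP->|up']; first by right.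
    left; split; first by apply: p1D; rewrite inE up' orbT.
    by apply: pz; rewrite Ep mem_cat up'.
  split=> //; exists p2 => //; split=> // u up'.
  split; first split; first by apply: Ap; rewrite mem_cat up' orbT.
    by move=> /= uy; have := dis u up'; rewrite /= uy mem_rcons mem_head.
  (* A return to [D] would be followed by another exit, again at [y] since [x] is excluded. *)
  move=> Du; case/splitPr: up' pth2 nDl dis Ap {up2 Ew Gp Ep} => q1 q2.
  rewrite cat_path last_cat /= => /and3P[_ _ pthq] nDl dis Ap.
  have [r1 [v [r2 [Eq2 _ bv]]]] := walk_exit pthq Du nDl.
  have vin : v \in q1 ++ u :: q2 by rewrite Eq2 !(mem_cat, inE) eqxx !orbT.
  have : v = y.
    apply: (cone_bd_eq e_2conn cD bx bv by_); last exact: nx.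
    by apply: nx; apply: Ap; rewrite mem_cat vin orbT.
  by move=> vy; have := dis v vin; rewrite /= vy mem_rcons mem_head.
- by rewrite cats0 -Ew pairmap_cat last_rcons.
Qed.

(** The two parts of a traversing walk are disjoint, as the second one avoids the piece and does not
    return to [y]. *)
Lemma rule_sound s a w Ms ws : valid s -> rule s a Ms ->
  factors id (map inl Ms) ws -> flatten ws = w -> Lng s (a :: w).
Proof.
case: s => K [[x A] G] vs [z [xz la Az cases]].
have [KKK [/= Px nAx sA sG]] := vs.
case: cases => [[Pz ->]|[nPz Gz ->]|[nPz [y [by_ Ay ->]]]].
- move=> /factors_one[_ -> [p [pth up Ap Gp] <-]] /=; rewrite cats0 => <-.
  exists (z :: p); last by rewrite /= la.
  split=> //=; rewrite ?xz ?up ?andbT //.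
    by apply/negP => /Ap[_ /(_ erefl)].
  by move=> u; rewrite inE => /orP[/eqP->//|/Ap[]].
- have [cD bx Dz Nz DA] := enter_piece vs nPz xz Az.
  move=> /factors_one[_ -> [p [pth up Ap Gp] <-]] /=; rewrite cats0 => <-.
  exists (z :: p); last by rewrite /= la.
  split=> //=; rewrite ?xz ?up ?andbT //.
  + by apply/negP => /Ap[[_ /(_ erefl)]|[_ []]].
  + by move=> u; rewrite inE => /orP[/eqP->//|/Ap[[/DA//]|[]//]].
  + exact: sG Gz.
have [cD bx Dz Nz DA] := enter_piece vs nPz xz Az.
have yz : y <> z by move=> yz; have [] := by_; rewrite yz.
move=> /factors_two[_ [_ [-> [p [pth up Ap ly] <-] [q [pthq uq Aq Gq] <-]]]].
rewrite /= cats0 => <-.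
rewrite /= in ly; exists (z :: p ++ q); last by rewrite /= la pairmap_cat ly.
split=> //=.
- by rewrite xz cat_path pth ly.
- rewrite cat_uniq up uq andbT mem_cat negb_or -andbA; apply/and3P; split.
  + by apply/negP => /Ap[[_ /(_ erefl)]|/esym].
  + by apply/negP => /Aq[_ /(_ Dz)].
  + apply/hasPn => u /Aq[[_ uy] nDu]; apply/negP => /Ap[[Du _]|//].
    exact: nDu.
- move=> u; rewrite inE mem_cat => /or3P[/eqP->//|/Ap[[/DA//]|->//]|/Aq[[]]//].
- by rewrite last_cat ly.
Qed.

(** Determinism recovers the walk from its labels, so only the place where it is cut remains to be
    determined. *)
Lemma rule_unique s a Ms Ms' ws ws' : valid s -> rule s a Ms -> rule s a Ms' ->
  factors id (map inl Ms) ws -> factors id (map inl Ms') ws' ->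
  flatten ws = flatten ws' -> Ms = Ms' /\ ws = ws'.
Proof.
case: s => K [[x A] G] vs [z [xz la Az cases]] [z' [xz' la' Az' cases']].
have Ez : z = z' by apply: l_det.1 xz xz' _; rewrite la.
subst z'.
have single M M' (v v' : seq (seq Sigma)) : M = M' ->
    factors id (map inl [:: M] : seq (_ + Sigma)) v ->
    factors id (map inl [:: M'] : seq (_ + Sigma)) v' ->
    flatten v = flatten v' -> [:: M] = [:: M'] /\ v = v'.
  move=> -> /factors_one[v1 -> _] /factors_one[v2 -> _] /=.
  by rewrite !cats0 => ->.
have [Pz|nPz] := pselect (part e K z).
  case: cases => [[_ ->]|[//]|[//]]; case: cases' => [[_ ->]|[//]|[//]].
  exact: single.
have [cD bx Dz Nz DA] := enter_piece vs nPz xz Az.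
(* The last vertex tells the two cases apart: after a traversal it is outside the piece. *)
have cross v v' B y G' : bd e (piece e K z) y ->
    factors id (map inl [:: walk_language e l z B (piece e K z)] : seq (_ + Sigma)) v ->
    factors id (map inl [:: walk_language e l z ((piece e K z `\ z) `|` [set y]) [set y];
                   walk_language e l y (A `\ y `\` piece e K z) G'] : seq (_ + Sigma)) v' ->
    flatten v <> flatten v'.
  move=> by_ /factors_one[_ -> [p [pth _ _ Dl] <-]].
  move=> /factors_two[_ [_ [-> [q [pthq _ _ ly] <-] [q' [pthq' uq Aq Gq] <-]]]].
  rewrite /= in ly; rewrite /= !cats0 -ly -pairmap_cat.
  move/(pairmap_walk_inj l_det); rewrite cat_path pthq ly pthq' => /(_ pth isT) Ep.
  move: Dl; rewrite Ep last_cat ly.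
  case/lastP: q' Aq {pthq' uq Gq Ep} => [|q' u] Aq; first by case: by_.
  rewrite last_rcons; have [|_ nDu] := Aq u; first by rewrite mem_rcons mem_head.
  exact: nDu.
case: cases => [[//]|[_ _ ->]|[_ [y [by_ Ay ->]]]];
  case: cases' => [[//]|[_ _ ->]|[_ [y' [by' Ay' ->]]]].
- exact: single.
- by move=> h h' E; case: (cross _ _ _ _ _ by' h h').
- by move=> h' h E; case: (cross _ _ _ _ _ by_ h h').
(* The first part of a traversal stops at the first vertex outside the piece, which fixes [y] and
   the cut. *)
have first_part p y0 : bd e (piece e K z) y0 -> uniq p ->
    (forall u, u \in p -> ((piece e K z `\ z) `|` [set y0]) u) -> last z p = y0 ->
    exists2 q, p = rcons q y0 & forall u, u \in q -> piece e K z u.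
  move=> by0 up pD; case/lastP: p up pD => [|q u] up pD.
    by move=> /= zy; case: by0; rewrite -zy.
  rewrite last_rcons => uy; rewrite uy in up pD *; exists q => // v vq.
  have [|[//]|/= vy] := pD v; first by rewrite mem_rcons inE vq orbT.
  by move: up; rewrite rcons_uniq -vy vq.
move=> /factors_two[_ [_ [-> [p [pth up pD ly] <-] [q [pthq _ _ _] <-]]]].
move=> /factors_two[_ [_ [-> [p' [pth' up' pD' ly'] <-] [q' [pthq' _ _ _] <-]]]].
rewrite /= in ly ly'; rewrite /= !cats0 -{1}ly -{1}ly' -!pairmap_cat => /(pairmap_walk_inj l_det).
rewrite !cat_path pth ly pthq pth' ly' pthq' => /(_ isT isT).
have [r Er rD] := first_part p y by_ up pD ly.
have [r' Er' rD'] := first_part p' y' by' up' pD' ly'.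
rewrite Er Er' => /(rcons_cat_inj rD rD')[||-> -> ->] //; first by case: by_.
by case: by'.
Qed.

Lemma walk_language_cfg K x A G : KK K -> ok (K, (x, A, G)) ->
  finite_set KK -> (forall K, KK K -> finite_set K /\ K !=set0) ->
  unambiguous_context_free (walk_language e l x A G).
Proof.
move=> KKK okK fKK KKfin.
apply: (@finite_states_grammar Sigma St valid Lng rule (K, (x, A, G))).
- by [].
- apply: (@sub_finite_set _ _
    (\bigcup_(K in KK) (Lng @` [set s | s.1 = K /\ ok s]))).
    by move=> _ [s [Ks os] <-]; exists s.1 => //; exists s.
  by apply: bigcup_finite => // K' /KKfin[fK K0]; exact: finite_ok_languages.
- exact: rule_valid.
- move=> s a w vs; split; first exact: rule_complete.
  by move=> [Ms [ws [Hr Hf Ew]]]; exact: rule_sound Hr Hf Ew.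
- exact: rule_unique.
Qed.

End States.

(** * Self-avoiding walks from [o] *)

Theorem theorem5p6 (V : choiceType) (e : rel V)
    (e_sym : symmetric e) (e_irr : irreflexive e)
    (e_2conn : two_connected e) (e_lf : locally_finite e)
    (Sigma : finType) (l : V -> V -> Sigma) (l_det : deterministic e l)
    (Gamma : set (V -> V)) (Gamma_aut : label_aut_subgroup e l Gamma)
    (Gamma_qt : quasi_transitive Gamma)
    (ends_le2 : forall w : set (nat -> V), is_end e w ->
       exists2 k : nat, end_size w k & k <= 2)
    (o : V) :
  unambiguous_context_free (saw_language e l o).
Proof.
have [[s0 /andP[us0 s03]] e_conn _] := e_2conn.
have part_fin K : finite_set K -> finite_set (part e K).
  exact: finite_part.
have [DD [fDD DD_cone DD_rep]] :=
  finite_cone_representatives e_sym e_2conn e_lf Gamma_aut Gamma_qt.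
(* [o] is included to make it a vertex of [part K0]; the vertices of [s0], at least three, make
   every [K0]-cone a cone. *)
pose K0 : set V := [set` o :: s0].
pose KK : set (set V) := [set K0] `|` (gate e @` DD).
have KK_big K : KK K -> exists s, [/\ uniq s, 2 < size s & forall z, z \in s -> K z].
  move=> [->|[D /DD_cone cD <-]].
    by exists s0; split=> // z zs; rewrite /K0 /= inE zs orbT.
  have [[x Dx] _ _ [v [nDv _]]] := cD.
  have [a ba] := boundary_point e_2conn Dx nDv.
  have [b [nba E]] := cone_bd2 e_2conn cD ba.
  have bb : bd e D b by rewrite E; right.
  have [nDa [c Dc ca]] := ba; have [nDb _] := bb.
  (* Three vertices of the gate: both boundary vertices, and a neighbour of [a] in [D]. *)
  exists [:: a; b; c]; split=> //.
    rewrite /= !inE negb_or -!andbA andbT; apply/and3P; split; apply/eqP.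
    - by move=> ab; apply: nba.
    - by move=> ac; apply: nDa; rewrite ac.
    - by move=> bc; apply: nDb; rewrite bc.
  move=> z; rewrite !inE => /or3P[] /eqP->; [by left|by left|right].
  by split=> //; exists a; rewrite // e_sym.
(* The initial state: [o] is used, every other vertex is allowed, and the walk may end anywhere. *)
have -> : saw_language e l o = walk_language e l o [set v | v <> o] setT.
  apply/seteqP; split=> w [p].
    move=> /andP[pth /= /andP[op up]] <-; exists p => //; split=> // z zp.
    by move=> zo; rewrite -zo zp in op.
  move=> [pth up po _] <-; exists p => //; apply/andP; split=> //=.
  by rewrite up andbT; apply/negP => /po.
have oP K : K = K0 -> part e K o by move=> ->; apply: sub_part; rewrite /K0 /= mem_head.
have KK_gate D : DD D -> KK (gate e D) by move=> DDD; right; exists D.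
have KK_cone K C : KK K -> kcone e K C -> cone e C by move/KK_big; exact: kcone_cone.
have KK0 : KK K0 by left.
apply: (walk_language_cfg e_sym e_2conn e_lf l_det Gamma_aut part_fin DD_cone DD_rep
  KK_gate KK_cone KK0).
- split=> //=; first exact: oP.
  by move=> v w vw _ wo; apply: (piece_sub_part vw); rewrite wo; exact: oP.
- by rewrite finite_setU; split; [exact: finite_set1 | exact: finite_image].
- move=> K KKK; split; last first.
    by have [[|z s] [_ s2 sK]] := KK_big K KKK; rewrite // ; exists z; apply: sK; rewrite mem_head.
  case: KKK => [->|[D /DD_cone cD <-]]; first by apply/finite_seqP; exists (o :: s0).
  have [_ _ bD _] := cD; have fb := finite_atmost bD.
  rewrite finite_setU; split=> //; apply: finite_setIr; exact: finite_nbrs.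
Qed.
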